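(* The Maximum Edge Open Packing problem can be solved in $O(n^3)$ time on distance-hereditary graphs; that is, there is an algorithm which, given any distance-hereditary graph $G$ with $n=|V(G)|$ vertices, computes the edge open packing number $\rho_e^o(G)$ in $O(n^3)$ time.
   Context: Graphs are finite, simple and undirected. Two distinct edges $e_1,e_2$ of a graph $G=(V,E)$ are said to conflict (to have a common edge) if there is an edge $e\in E\setminus\{e_1,e_2\}$ joining an endpoint of $e_1$ to an endpoint of $e_2$. (So two edges with a common endpoint conflict exactly when they lie in a triangle of $G$, and two disjoint edges conflict exactly when some edge of $G$ joins an endpoint of one to an endpoint of the other.) A set $D\subseteq E$ is an edge open packing set of $G$ if no two distinct edges of $D$ conflict. The edge open packing number $\rho_e^o(G)$ is the maximum cardinality of an edge open packing set of $G$. The Maximum Edge Open Packing problem is: given a graph $G$, determine $\rho_e^o(G)$. A graph $G$ is distance-hereditary if, for every pair of vertices, their distance in $G$ remains unchanged in every connected induced subgraph of $G$ containing them. *)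

(* Defs.v *)
From mathcomp Require Import all_boot.

Set Implicit Arguments.
Unset Strict Implicit.
Unset Printing Implicit Defensive.

Record sgraph := SGraph {
  vertex :> finType;
  adj : rel vertex;
  adj_sym : symmetric adj;
  adj_irrefl : irreflexive adj }.

Definition edges (G : sgraph) : {set {set G}} :=
  [set e : {set G} | [exists x : G, exists y : G, adj x y && (e == [set x; y])]].

Definition conflict (G : sgraph) (e1 e2 : {set G}) : bool :=
  [exists e in edges G :\: [set e1; e2],
    [exists x in e1, exists y in e2, e == [set x; y]]].

Definition edge_open_packing (G : sgraph) (D : {set {set G}}) : bool :=
  (D \subset edges G) &&
  [forall e1 in D, forall e2 in D, (e1 != e2) ==> ~~ conflict e1 e2].

Definition eop_number (G : sgraph) : nat :=
  \max_(D : {set {set G}} | edge_open_packing D) #|D|.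

Definition induced_adj (G : sgraph) (A : {set G}) : rel {x : G | x \in A} :=
  fun u v => adj (val u) (val v).

Lemma induced_adj_sym (G : sgraph) (A : {set G}) : symmetric (@induced_adj G A).
Proof. by move=> u v; apply: adj_sym. Qed.

Lemma induced_adj_irrefl (G : sgraph) (A : {set G}) :
  irreflexive (@induced_adj G A).
Proof. by move=> u; apply: adj_irrefl. Qed.

Definition induced (G : sgraph) (A : {set G}) : sgraph :=
  SGraph (@induced_adj_sym G A) (@induced_adj_irrefl G A).

Definition is_connected (G : sgraph) : Prop :=
  forall x y : G, connect (@adj G) x y.

(* The relation "d is the distance from x to y"; it holds for no d when x and
   y lie in different components. *)
Definition is_dist (G : sgraph) (x y : G) (d : nat) : Prop :=
  (exists p : seq G, [/\ path (@adj G) x p, last x p = y & size p = d]) /\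
  (forall p : seq G, path (@adj G) x p -> last x p = y -> d <= size p).

(* G itself is not required to be connected. *)
Definition distance_hereditary (G : sgraph) : Prop :=
  forall A : {set G}, is_connected (induced A) ->
  forall (x y : induced A) (d : nat),
    is_dist x y d <-> is_dist (val x) (val y) d.

(* Running time is measured on a unit-cost random access machine with words of
   w bits, presented as a structured language.  A program names finitely many
   registers and has one memory, indexed by words.  Every operation of an
   expression and every elementary command costs one unit. *)
Inductive binop := OpAdd | OpSub | OpMul | OpLeq | OpEq.

Inductive expr :=
  | Num of nat
  | Reg of nat
  | Fetch of expr
  | Op of binop & expr & expr.

Inductive cmd :=
  | Skip
  | SetReg of nat & expr
  | Store of expr & expr (* address, value *)
  | Seq of cmd & cmd
  | If of expr & cmd & cmd
  | While of expr & cmd.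

Record state := State { regs : nat -> nat; cells : nat -> nat }.

Definition eval_op (o : binop) (a b : nat) : nat :=
  match o with
  | OpAdd => a + b
  | OpSub => a - b
  | OpMul => a * b
  | OpLeq => a <= b
  | OpEq => a == b
  end.

Definition word (w v : nat) : option nat := if v < 2 ^ w then Some v else None.

(* None signals an overflow: a value that does not fit in a word. *)
Fixpoint eval (w : nat) (s : state) (e : expr) : option nat :=
  match e with
  | Num k => word w k
  | Reg r => word w (regs s r)
  | Fetch a => if eval w s a is Some i then word w (cells s i) else None
  | Op o e1 e2 =>
      match eval w s e1, eval w s e2 with
      | Some a, Some b => word w (eval_op o a b)
      | _, _ => None
      end
  end.

Fixpoint cost (e : expr) : nat :=
  match e with
  | Num _ | Reg _ => 1
  | Fetch a => (cost a).+1
  | Op _ e1 e2 => (cost e1 + cost e2).+1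
  end.

Definition update (f : nat -> nat) (i v : nat) : nat -> nat :=
  fun j => if j == i then v else f j.

(* [exec w c s t s']: with w-bit words, c started in s halts in s' after t
   units of time.  There is no derivation for a run that overflows. *)
Inductive exec (w : nat) : cmd -> state -> nat -> state -> Prop :=
  | ExecSkip s : exec w Skip s 1 s
  | ExecSetReg r e s v : eval w s e = Some v ->
      exec w (SetReg r e) s (cost e).+1 (State (update (regs s) r v) (cells s))
  | ExecStore a e s i v : eval w s a = Some i -> eval w s e = Some v ->
      exec w (Store a e) s (cost a + cost e).+1
        (State (regs s) (update (cells s) i v))
  | ExecSeq c1 c2 s1 s2 s3 t1 t2 : exec w c1 s1 t1 s2 -> exec w c2 s2 t2 s3 ->
      exec w (Seq c1 c2) s1 (t1 + t2) s3
  | ExecIf e c1 c2 s s' v t : eval w s e = Some v ->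
      exec w (if v != 0 then c1 else c2) s t s' ->
      exec w (If e c1 c2) s (cost e + t).+1 s'
  | ExecWhileStop e c s : eval w s e = Some 0 ->
      exec w (While e c) s (cost e).+1 s
  | ExecWhileLoop e c s1 s2 s3 v t1 t2 : eval w s1 e = Some v -> v != 0 ->
      exec w c s1 t1 s2 -> exec w (While e c) s2 t2 s3 ->
      exec w (While e c) s1 (cost e + t1 + t2).+1 s3.

(* The number n of vertices is in register 0, the row-major adjacency matrix
   in memory cells 0, ..., n^2 - 1; everything else is 0. *)
Definition input (G : sgraph) : state :=
  State (fun r => if r == 0 then #|G| else 0)
        (fun a => [exists x : G, exists y : G,
           (a == enum_rank x * #|G| + enum_rank y) && adj x y]).

Definition output (s : state) : nat := regs s 0.

Definition bigO (f g : nat -> nat) : Prop :=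
  exists c N : nat, forall n, N <= n -> f n <= c * g n.

(* A single program, on words of O(log n) bits, computes f on the whole class C
   in time O(T n), n being the number of vertices. *)
Definition solvable_in_time (C : sgraph -> Prop) (f : sgraph -> nat)
    (T : nat -> nat) : Prop :=
  exists (P : cmd) (k : nat) (T' : nat -> nat),
    bigO T' T /\
    forall G : sgraph, C G ->
      exists (t : nat) (s : state),
        [/\ exec (k * up_log 2 #|G|.+2) P (input G) t s,
            t <= T' #|G| & output s = f G].

(* Main.v *)
From HB Require Import structures.
Require Import Defs.
From mathcomp Require Import all_boot.
From mathcomp Require Import zify.

(* An edge open packing is the edge set of an induced subgraph all of whose
   components are stars, so the edge open packing number is the largest number of
   leaves of an induced star forest.  A distance-hereditary graph can be dismantled
   by repeatedly deleting a vertex [v] that is a twin of some [u], or whose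
   neighbourhood is contained in [{u}].  Give each vertex weights for four roles:
   unused, leaf, centre, or "used, with no further used neighbour".  When [v] is
   deleted, the outside world sees the pair [u], [v] as one vertex in one of these
   four roles, so the weights of [v] can be merged into those of [u] without
   changing the optimum.  To find a deletable vertex in quadratic time, the program
   maintains for all [x], [y] the number of remaining vertices adjacent to exactly
   one of [x], [y]; updating the table after a deletion is quadratic as well. *)

(** Everything is phrased for an arbitrary set [A] of remaining vertices of the fixed graph: the
    hypothesis on distances speaks of all connected vertex sets, so it applies inside [A] directly.
    A deletable vertex is then needed in every set with at least two elements, connected or not,
    which is why an isolated vertex counts as deletable.

    Merging is exact because every other vertex sees [v] either exactly as it sees [u] or not at
    all. The fourth role closes the system under merging: a leaf and a centre that are adjacent
    twins, or two centres that are nonadjacent twins, tolerate no further used neighbour, since a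
    common neighbour would create a triangle or a leaf with two centres.

    Both kinds of deletion are recognised by comparing one table entry with an adjacency value.
    Twins are distinguished by no third vertex; a vertex with neighbourhood inside [{u}] is compared
    with an artificial vertex that has no neighbours.

    A merged weight never exceeds the number of original vertices it stands for, and memory
    addresses are quadratic in [n], so words of logarithmic length suffice. *)

Set Implicit Arguments.
Unset Strict Implicit.
Unset Printing Implicit Defensive.

(** * Twins and pendant vertices in distance-hereditary graphs *)

Section Structure.
Variable G : sgraph.
Implicit Types (A C K M X : {set G}) (x y z u v : G).

(** Connectivity expressed by cuts. Being boolean, it can enter the predicate for which a largest
    set is chosen in [dh_prunable], and adding a vertex requires no manipulation of paths. *)
Definition linked A : bool :=
  [forall X : {set G}, (X \subset A) && (X != set0) && (X != A) ==>
    [exists x in X, exists y in A :\: X, adj x y]].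

Lemma linkedP A :
  reflect (forall X, X \subset A -> X != set0 -> X != A ->
             exists x y, [/\ x \in X, y \in A :\: X & adj x y])
          (linked A).
Proof.
apply: (iffP forallP) => [lA X XA X0 nXA | lA X].
  have /existsP[x /andP[xX /existsP[y /andP[yA xy]]]] :=
    implyP (lA X) (introT andP (conj (introT andP (conj XA X0)) nXA)).
  by exists x, y.
apply/implyP=> /andP[/andP[XA X0] nXA]; have [x [y [xX yA xy]]] := lA X XA X0 nXA.
by apply/existsP; exists x; rewrite xX; apply/existsP; exists y; rewrite yA.
Qed.

Lemma linkedU1 K y s : linked K -> y \in K -> adj y s -> linked (s |: K).
Proof.
move=> /linkedP lK yK ays; apply/linkedP => X sXA X0 XA.
have [sK|sK] := boolP (s \in K).
  by move: sXA XA; rewrite (setUidPr _) ?sub1set // => ? ?; apply: lK.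
have [KX|nKX] := boolP (K \subset X).
  have sX : s \notin X.
    apply: contraNN XA => sX; rewrite eqEsubset sXA subUset sub1set sX //=.
  exists y, s; split=> //; first exact: (subsetP KX).
  by rewrite !inE sX eqxx.
have [XK0|XK0] := eqVneq (X :&: K) set0.
  have Xs : s \in X.
    case/set0Pn: X0 => x xX; move: (subsetP sXA _ xX); rewrite !inE.
    case/orP=> [/eqP<- //|xK]; move/setP: XK0 => /(_ x).
    by rewrite !inE xX xK.
  exists s, y; split=> //; last by rewrite adj_sym.
  rewrite !inE yK orbT andbT; apply/negP => yX.
  by move/setP: XK0 => /(_ y); rewrite !inE yX yK.
case: (lK (X :&: K)) => //; first exact: subsetIr.
  by apply: contraNN nKX => /eqP <-; apply: subsetIl.
move=> a [b [aX bX ab]]; exists a, b; move: aX bX; rewrite !inE.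
case/andP=> aX aK /andP[bX bK]; split=> //.
by rewrite bK orbT andbT; apply: contraNN bX => ->.
Qed.

Lemma linked1 x : linked [set x].
Proof.
by apply/linkedP => X; rewrite subset1 => /orP[]/eqP->; rewrite ?eqxx.
Qed.

(** Otherwise the vertices reachable from [x] would form a cut of [A] crossed by no edge. *)
Lemma linked_connected A : linked A -> is_connected (induced A).
Proof.
move=> /linkedP lA x y; apply: contraT => nxy.
pose X := [set val z | z : induced A & connect (@adj (induced A)) x z].
have xX : val x \in X by apply/imsetP; exists x; rewrite ?inE.
have sub : X \subset A by apply/subsetP=> _ /imsetP[z _ ->]; apply: valP.
have yX : val y \notin X.
  by apply/imsetP => -[z]; rewrite inE => xz /val_inj yz; rewrite yz xz in nxy.
case: (lA X sub).
- by apply/set0Pn; exists (val x).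
- by apply: contraNneq yX => ->; apply: valP.
move=> a [b [/imsetP[a' ca ->]]]; rewrite !inE in ca *.
case/andP=> bX bA ab; case/imsetP: bX.
exists (Sub b bA : induced A); last by rewrite SubK.
rewrite inE; apply: connect_trans ca (connect1 _).
by have -> : adj a' (Sub b bA : induced A) = adj (val a') b by [].
Qed.

Hypothesis dhG : distance_hereditary G.

(* Only distances equal to two are ever used. *)
Lemma dh_common_neighbour A x y z :
  linked A -> x \in A -> y \in A -> x != y -> ~~ adj x y -> adj x z -> adj z y ->
  exists2 c, c \in A & adj x c && adj c y.
Proof.
move=> lA xA yA xy nxy axz azy.
pose x' : induced A := Sub x xA; pose y' : induced A := Sub y yA.
(* The path through [z] shows that the distance in the whole graph is two. It is also two inside
   [A], and the middle vertex of a shortest path there is the required [c]. *)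
have d2 : is_dist (val x') (val y') 2.
  rewrite !SubK; split; first by exists [:: z; y]; split=> //=; rewrite axz azy.
  case=> [|a [|b p]] //=; first by move=> _ exy; rewrite exy eqxx in xy.
  by rewrite andbT => axa eay; rewrite -eay axa in nxy.
have /(dhG (linked_connected lA))[[p [pp lp sp]] _] := d2.
case: p pp lp sp => [|a [|b []]] //=; rewrite andbT => /andP[xa ab] eb _.
exists (val a); first exact: valP.
by rewrite -[x](SubK (induced A) xA) -[y](SubK (induced A) yA) -/x' -/y' -eb; apply/andP.
Qed.

(** * Sets without an induced path on four vertices (cographs) *)

Definition P4free A := forall a b c d, a \in A -> b \in A -> c \in A -> d \in A ->
  adj a b -> adj b c -> adj c d -> ~~ adj a c -> ~~ adj b d -> ~~ adj a d ->
  a != d -> False.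

(* The complement of a path on four vertices is again such a path. *)
Lemma P4free_colour A k a b c d : P4free A ->
  a \in A -> b \in A -> c \in A -> d \in A ->
  adj a b = ~~ k -> adj b c = ~~ k -> adj c d = ~~ k ->
  adj a c = k -> adj b d = k -> adj a d = k -> a != d -> c != b -> False.
Proof.
case: k => /= p4 aA bA cA dA ab bc cd ac bd ad nad ncb; last first.
  by apply: (p4 a b c d); rewrite ?ab ?bc ?cd ?ac ?bd ?ad.
by apply: (p4 c a d b); rewrite ?ad ?cd ?ab // adj_sym ?ac ?bd ?bc.
Qed.

(* The colour [k] of a pair is [true] for edges and [false] for non-edges. *)
Definition uniform_split (k : bool) A X :=
  [/\ X \subset A, X != set0, X != A &
      forall x y, x \in X -> y \in A :\: X -> adj x y = k].

Lemma P4free_sub A X : X \subset A -> P4free A -> P4free X.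
Proof.
by move=> /subsetP XA p4 a b c d /XA aA /XA bA /XA cA /XA dA; apply: p4.
Qed.

(** Seinsche's theorem: such a graph or its complement is disconnected. By induction [A :\ v] splits
    into [X] and [Y] with colour [k] between them. If [v] has colour [k] to all of one side, that
    side splits off; otherwise the split is read off from the colours at [v]. *)
Lemma P4free_split A : P4free A -> 1 < #|A| -> exists k X, uniform_split k A X.
Proof.
have [m] := ubnP #|A|; elim: m A => // m IH A Am p4 A1.
have [v vA] : exists v, v \in A by apply/set0Pn; rewrite -card_gt0; lia.
have cA' : #|A :\ v| = #|A|.-1 by have := cardsD1 v A; rewrite vA; lia.
have [cA'1|cA'1] : #|A :\ v| = 1 \/ 1 < #|A :\ v| by lia.
  have /cards1P[y eA'] : #|A :\ v| == 1 by apply/eqP.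
  exists (adj v y), [set v]; split.
  - by rewrite sub1set.
  - by apply/set0Pn; exists v; rewrite inE.
  - by apply/negP => /eqP eA; move: A1; rewrite -eA cards1.
  - by move=> x z; rewrite eA' !inE => /eqP-> /eqP->.
have [|k [X [XA X0 XA' sX]]] := IH (A :\ v) _ (P4free_sub (subD1set _ _) p4) cA'1.
  lia.
have vX : v \notin X by apply/negP => /(subsetP XA); rewrite !inE eqxx.
have XsA := subset_trans XA (subD1set A v).
pose Y := (A :\ v) :\: X.
have YsA : Y \subset A by apply/subsetP => y; rewrite !inE => /and3P[].
have Y0 : Y != set0.
  by apply: contra XA'; rewrite setD_eq0 => AX; rewrite eqEsubset XA.
have side y : y \in A -> y != v -> (y \in Y) = (y \notin X).
  by move=> yA yv; rewrite !inE yA yv /= andbT.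
have properA (B : {set G}) : v \notin B -> B != A by apply: contraNneq => ->.
have vY : v \notin Y by rewrite !inE eqxx /= andbF.
have [NX|/pred0Pn[p /andP[/= pX vp]]] := eqVneq #|[pred p in X | adj v p != k]| 0.
  exists k, X; split=> // [|x y xX]; first exact: properA.
  rewrite inE => /andP[yX yA]; have [->|yv] := eqVneq y v.
    move/card0_eq: NX => /(_ x); rewrite inE xX /= adj_sym.
    by move/negbFE/eqP.
  by apply: sX => //; rewrite !inE yX yv.
have [NY|/pred0Pn[q /andP[/= qY vq]]] := eqVneq #|[pred p in Y | adj v p != k]| 0.
  exists k, Y; split=> // [|x y xY]; first exact: properA.
  rewrite inE => /andP[yY yA]; have [->|yv] := eqVneq y v.
    move/card0_eq: NY => /(_ x); rewrite inE xY /= adj_sym.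
    by move/negbFE/eqP.
  by rewrite adj_sym; apply: sX => //; move: yY; rewrite side // negbK.
(* Now [v] has a pair of the other colour on both sides, witnessed by [p] and [q]. The set [R] is to
   be split off, or [v] itself if [R] is empty. *)
pose R := [set y in A :\ v | adj v y == k].
have RsA : R \subset A by apply/subsetP => y; rewrite !inE => /andP[/andP[]].
have vR : v \notin R by rewrite !inE eqxx.
have [R0|R0] := eqVneq R set0.
  exists (~~ k), [set v]; split; rewrite ?sub1set //.
  - by apply/set0Pn; exists v; rewrite inE.
  - by apply/negP => /eqP eA; move: A1; rewrite -eA cards1.
  - move=> x y; rewrite inE => /eqP->; rewrite !inE => /andP[yv yA].
    move/setP: R0 => /(_ y); rewrite !inE yv yA /=.
    by case: (adj v y) k {sX vp vq R RsA vR} => -[].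
exists k, R; split=> // [|x y]; first exact: properA.
rewrite !inE => /andP[/andP[xv xA] /eqP vx] /andP[+ yA].
have [-> _|yv] := eqVneq y v; first by rewrite adj_sym.
rewrite yA /= => vy; apply/eqP; apply: contraT => xy.
have qA := subsetP YsA _ qY; have pA := subsetP XsA _ pX.
(* In colour [~~ k] the vertices [x], [y], [v], [z] would form an induced path. Since [x] and [y]
   must lie on the same side of the old split, the witness on the opposite side serves as [z]. *)
have key z : z \in A -> adj v z != k -> adj x z = k -> adj y z = k -> False.
  move=> zA vz xz yz.
  have neg b : b != k -> b = ~~ k by case: b k {sX vp vq R RsA vR R0 vx vy xy vz xz yz} => -[].
  apply: (@P4free_colour A k x y v z) => //; rewrite 1?[adj y v]adj_sym ?[adj x v]adj_sym //.
  - exact: neg.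
  - exact: neg.
  - exact: neg.
  - by apply: contraNneq vz => <-; rewrite vx.
  - by rewrite eq_sym.
have eside : (x \in X) = (y \in X).
  apply/idP/idP => [xX|yX]; apply: contraNT xy => nX; apply/eqP.
    by apply: sX => //; rewrite !inE nX yv.
  by rewrite adj_sym; apply: sX => //; rewrite !inE nX xv.
have [xX|xX] := boolP (x \in X).
  have yX : y \in X by rewrite -eside.
  by case: (key q) => //; apply: sX.
have yX : y \notin X by rewrite -eside.
have pY : forall z, z \in A -> z != v -> z \notin X -> adj z p = k.
  by move=> z zA zv zX; rewrite adj_sym; apply: sX => //; rewrite !inE zX zv.
by case: (key p) => //; apply: pY.
Qed.

Definition twins A u v := [/\ u \in A, v \in A, u != v &
  forall z, z \in A -> z != u -> z != v -> adj u z = adj v z].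

Definition module A X := X \subset A /\
  forall x y z, x \in X -> y \in X -> z \in A :\: X -> adj x z = adj y z.

Lemma module_twins A X u v : module A X -> twins X u v -> twins A u v.
Proof.
move=> [/subsetP XA mX] [uX vX uv tw]; split; [exact: XA|exact: XA|by []|].
move=> z zA zu zv; have [zX|zX] := boolP (z \in X); first exact: tw.
by apply: mX; rewrite ?inE ?zX.
Qed.

(** Both sides of a uniform split are modules, and twins of a module are twins of [A], so the
    induction enters a side with two vertices or more. If both sides are singletons, their two
    vertices are twins. *)
Lemma P4free_twins A : P4free A -> 1 < #|A| -> exists u v, twins A u v.
Proof.
have [m] := ubnP #|A|; elim: m A => // m IH A Am p4 A1.
have [k [X [XA X0 nXA sX]]] := P4free_split p4 A1.
have cA : #|A| = #|X| + #|A :\: X| by rewrite -(cardsID X) (setIidPr XA).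
have Y0 : 0 < #|A :\: X|.
  by rewrite card_gt0 setD_eq0; apply: contra nXA => ?; rewrite eqEsubset XA.
have X0' : 0 < #|X| by rewrite card_gt0.
have [X1|X1] := ltnP 1 #|X|.
  have [|u [v uv]] := IH X _ (P4free_sub XA p4) X1; first lia.
  exists u, v; apply: module_twins uv; split=> // x y z xX yX zX.
  by rewrite !sX.
have [Y1|Y1] := ltnP 1 #|A :\: X|.
  have [|u [v uv]] := IH (A :\: X) _ (P4free_sub (subsetDl _ _) p4) Y1; first lia.
  exists u, v; apply: module_twins uv; split; first exact: subsetDl.
  move=> x y z xY yY zX; rewrite adj_sym [RHS]adj_sym !sX //;
  by move: zX; rewrite !inE negb_and negbK => /andP[/orP[//|/negP nA] /nA].
have /cards1P[x eX] : #|X| == 1 by rewrite eqn_leq X1.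
have /cards1P[y eY] : #|A :\: X| == 1 by rewrite eqn_leq Y1.
have : y \in A :\: X by rewrite eY inE.
rewrite inE => /andP[yX yA]; have xX : x \in X by rewrite eX inE.
exists x, y; split=> //; first exact: (subsetP XA).
  by apply: contraNneq yX => <-.
move=> z zA zx zy; have : z \in A :\: X by rewrite inE zA eX inE zx.
by rewrite eY inE (negPf zy).
Qed.

(** The ends of an induced path in [X] have the common neighbour [s], hence would have one on the
    connected path itself, but no vertex of the path is adjacent to both ends. *)
Lemma common_neighbour_P4free X s : {in X, forall x, adj x s} -> P4free X.
Proof.
move=> Xs a b c d aX bX cX dX ab bc cd nac nbd nad ad.
pose P := d |: (c |: (b |: [set a])).
have lP : linked P.
  apply: (@linkedU1 _ c); rewrite ?inE ?eqxx //.
  apply: (@linkedU1 _ b); rewrite ?inE ?eqxx //.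
  by apply: (@linkedU1 _ a); rewrite ?inE ?eqxx //; apply: linked1.
have aP : a \in P by rewrite !inE eqxx !orbT.
have dP : d \in P by rewrite !inE eqxx.
have sd : adj s d by rewrite adj_sym Xs.
have [e eP /andP[ae ed]] := dh_common_neighbour lP aP dP ad nad (Xs _ aX) sd.
move: eP ae ed; rewrite !inE => /or4P[]/eqP->.
- by rewrite (negPf nad).
- by rewrite (negPf nac).
- by rewrite (negPf nbd).
- by rewrite adj_irrefl.
Qed.

(** One equation for both kinds: [t = true] means twins, adjacent or not; [t = false] means that [v]
    has no neighbour in [A] except possibly [u], so for an isolated [v] any other [u] will do. *)
Definition prunable A (t : bool) u v :=
  [/\ u \in A, v \in A, u != v &
      forall z, z \in A -> z != u -> z != v -> adj v z = t && adj u z].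

Lemma twins_prunable A u v : twins A u v -> prunable A true u v.
Proof. by case=> uA vA uv tw; split=> // z zA zu zv; rewrite tw. Qed.

(** A component is a smallest nonempty part of [A] that no edge leaves: a cut of it without crossing
    edges would give a smaller one. *)
Lemma component A : A != set0 ->
  exists C, [/\ C \subset A, C != set0, linked C &
    forall x y, x \in C -> y \in A :\: C -> ~~ adj x y].
Proof.
move=> A0; pose P (C : {set G}) := [&& C \subset A, C != set0 &
  [forall x in C, forall y in A :\: C, ~~ adj x y]].
have PA : P A.
  by rewrite /P subxx A0; apply/forall_inP => x _; apply/forall_inP => y; rewrite setDv inE.
case: (arg_minnP (fun C : {set G} => #|C|) PA) => C /and3P[CA C0 /forall_inP cC] minC.
exists C; split=> // [|x y xC]; last by move: y; apply/forall_inP; apply: cC.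
apply/linkedP => X XC X0 nXC.
have [/existsP[x /andP[xX /existsP[y /andP[yX xy]]]]|nX] :=
  boolP [exists x in X, exists y in C :\: X, adj x y]; first by exists x, y.
have PX : P X.
  rewrite /P X0 (subset_trans XC CA); apply/forall_inP => x xX.
  apply/forall_inP => y; rewrite inE => /andP[yX yA]; apply/negP => xy.
  have [yC|yC] := boolP (y \in C).
    case/negP: nX; apply/existsP; exists x; rewrite xX; apply/existsP; exists y.
    by rewrite inE yX yC.
  have /forall_inP/(_ y) := cC x (subsetP XC _ xX).
  by rewrite inE yC yA xy => /(_ isT).
have := proper_card (_ : X \proper C); rewrite properEneq nXC XC => /(_ isT).
by have := minC X PX; lia.
Qed.

(* Take a connected [K] maximal among those not dominating the component [C].
   The undominated part [R] is then complete to the neighbourhood [S] of [K],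
   so [R] is a module; if [R] is a single vertex, then [S] is a module. *)
Lemma dh_prunable A : 1 < #|A| -> exists t u v, prunable A t u v.
Proof.
move=> A1; have [|C [CA C0 lC cC]] := @component A; first by rewrite -card_gt0; lia.
have [C1|C1] := leqP #|C| 1.
  have /cards1P[v eC] : #|C| == 1 by rewrite eqn_leq C1 card_gt0.
  have vC : v \in C by rewrite eC inE.
  have [u] : exists u, u \in A :\ v.
    apply/set0Pn; rewrite -card_gt0.
    by have := cardsD1 v A; rewrite (subsetP CA _ vC); lia.
  rewrite !inE => /andP[uv uA]; exists false, u, v; split=> //.
    exact: (subsetP CA).
  by move=> z zA zu zv; apply/negbTE/cC; rewrite // eC !inE zv.
pose dom (K : {set G}) z := (z \in K) || [exists y in K, adj y z].
pose P (K : {set G}) := [&& K \subset C, K != set0, linked K & [exists z in C, ~~ dom K z]].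
have [r /andP[rC Pr]|allP] := pickP [pred r | (r \in C) && P [set r]]; last first.
  (* Every single vertex dominates [C], so [C] is complete and any two of its vertices are twins. *)
  case/card_gt1P: C1 => u [v [uC vC uv]]; exists true, u, v; split=> //;
    [exact: (subsetP CA)|exact: (subsetP CA)|move=> z zA zu zv /=].
  have [zC|zC] := boolP (z \in C); last first.
    by rewrite !(negPf (cC _ _ _ _)) // inE zC.
  have full x y : x \in C -> y \in C -> y != x -> adj x y.
    move=> xC yC yx; move/negbT: (allP x); rewrite /= xC /P sub1set xC linked1 /=.
    have -> /= : [set x] != set0 by apply/set0Pn; exists x; rewrite inE.
    move/existsPn => /(_ y); rewrite yC /= negbK /dom inE (negPf yx) /=.
    by case/existsP=> x' /andP[]; rewrite inE => /eqP->.
  by rewrite !full.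
case: (arg_maxnP (fun K : {set G} => #|K|) Pr) => K /and4P[KC K0 lK].
case/existsP=> v /andP[vC vK] maxK.
pose R := [set z in C | ~~ dom K z].
pose S := [set z in C :\: K | [exists y in K, adj y z]].
have vR : v \in R by rewrite inE vC.
have RK z y : z \in R -> y \in K -> adj y z = false.
  rewrite inE negb_or => /and3P[_ _ /existsPn/(_ y)] nyz yK.
  by move: nyz; rewrite yK => /negbTE.
have SK s : s \in S -> [/\ s \in C, s \notin K & exists2 y, y \in K & adj y s].
  by rewrite !inE -andbA => /and3P[? ? /exists_inP].
have SR s z : s \in S -> z \in R -> adj s z.
  move=> /SK[sC sK [y yK ys]] zR.
  (* The larger set [s |: K] is still connected, so by maximality of [K] it dominates [C]. As no
     vertex of [K] reaches [z], it is [s] that does. *)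
  have ldom : dom (s |: K) z.
    apply: contraT => ndom; have := maxK (s |: K); rewrite cardsU1 sK /=.
    suff -> : P (s |: K) by move/(_ isT); rewrite add1n ltnn.
    rewrite /P subUset sub1set sC KC (linkedU1 lK yK ys) /=; apply/andP; split.
      by apply/set0Pn; exists s; rewrite !inE eqxx.
    by apply/existsP; exists z; rewrite ndom andbT; move: zR; rewrite inE => /andP[].
  have zK : z \notin K by move: zR; rewrite inE negb_or => /and3P[].
  move: ldom; rewrite /dom !inE (negPf zK) orbF => /orP[/eqP zs|].
    by move: (RK z y zR yK); rewrite zs ys.
  case/existsP=> y'; rewrite !inE => /andP[/orP[/eqP-> //|y'K]].
  by rewrite RK.
have cover z : z \in C -> [|| z \in K, z \in S | z \in R].
  move=> zC; rewrite !inE zC /dom; case: (z \in K) => //=.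
  by case: [exists y in K, adj y z].
have RC : R \subset C by apply/subsetP => z; rewrite inE => /andP[].
have SC : S \subset C by apply/subsetP => z; rewrite !inE => /andP[/andP[]].
have RsA := subset_trans RC CA; have SsA := subset_trans SC CA.
have outC x z : x \in C -> z \in A -> z \notin C -> adj x z = false.
  by move=> xC zA zC; apply/negbTE/cC; rewrite // inE zC.
have [s sS] : exists s, s \in S.
  have [|x [y [xK]]] := linkedP _ lC K KC K0.
    by apply: contraNneq vK => eK; rewrite /dom eK vC.
  rewrite inE => /andP[yK yC] xy; exists y; rewrite !inE yC yK /=.
  by apply/existsP; exists x; rewrite xK.
have [R1|R1] := ltnP 1 #|R|.
  have p4R : P4free R.
    by apply: (@common_neighbour_P4free _ s) => x xR; rewrite adj_sym SR.
  have [a [b tw]] := P4free_twins p4R R1.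
  exists true, a, b; apply/twins_prunable/(module_twins _ tw); split=> // x y z xR yR.
  rewrite inE => /andP[zR zA]; have [zC|zC] := boolP (z \in C); last first.
    by rewrite !outC // (subsetP RC).
  case/or3P: (cover z zC) => [zK|zS|]; last by rewrite (negPf zR).
    by rewrite adj_sym (RK x) // adj_sym RK.
  by rewrite adj_sym SR // adj_sym SR.
have /cards1P[v' eR] : #|R| == 1.
  by rewrite eqn_leq R1 card_gt0; apply/set0Pn; exists v.
have {v'}eR : R = [set v] by move: vR; rewrite eR inE => /eqP ->.
have inR z : z \in R -> z = v by rewrite eR inE => /eqP.
have [S1|S1] := ltnP 1 #|S|.
  have p4S : P4free S by apply: (@common_neighbour_P4free _ v) => x xS; apply: SR.
  have [a [b tw]] := P4free_twins p4S S1.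
  exists true, a, b; apply/twins_prunable/(module_twins _ tw); split=> // x y z xS yS.
  rewrite inE => /andP[zS zA]; have [zC|zC] := boolP (z \in C); last first.
    by rewrite !outC // (subsetP SC).
  case/or3P: (cover z zC) => [zK||/inR->]; [|by rewrite (negPf zS)|by rewrite !SR].
  (* The vertices [v] and [z] have the common neighbour [q], hence also one in the connected set
     formed by [v], [p] and [K]. There [p] is the only neighbour of [v]. *)
  have half p q : p \in S -> q \in S -> adj q z -> adj p z.
    move=> pS qS qz; have [pC pK [y' y'K py']] := SK p pS.
    have lP : linked (v |: (p |: K)).
      apply: (@linkedU1 _ p); rewrite ?inE ?eqxx ?SR //.
      exact: (linkedU1 lK y'K).
    have vP : v \in v |: (p |: K) by rewrite !inE eqxx.
    have zP : z \in v |: (p |: K) by rewrite !inE zK !orbT.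
    have vz : v != z by apply: contraNneq vK => ->; rewrite /dom zK.
    have nvz : ~~ adj v z by rewrite adj_sym RK.
    have vq : adj v q by rewrite adj_sym SR.
    have [c] := dh_common_neighbour lP vP zP vz nvz vq qz.
    rewrite !inE => /or3P[/eqP->|/eqP-> /andP[_ ->] //|cK].
      by rewrite adj_irrefl.
    by rewrite adj_sym RK.
  by apply/idP/idP; apply: half.
have /cards1P[s' eS] : #|S| == 1.
  by rewrite eqn_leq S1 card_gt0; apply/set0Pn; exists s.
have {s'}eS : S = [set s] by move: sS; rewrite eS inE => /eqP ->.
(* With [R = [set v]] and [S = [set s]], the vertex [v] is pendant at [s]. *)
exists false, s, v; split; [exact: (subsetP SsA)|exact: (subsetP RsA)| |].
  by apply/eqP => sv; have := SR s v sS vR; rewrite sv adj_irrefl.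
move=> z zA zs zv /=; have [zC|zC] := boolP (z \in C); last by rewrite outC.
case/or3P: (cover z zC) => [zK||/inR ezv]; last by rewrite ezv eqxx in zv.
  by rewrite adj_sym RK.
by rewrite eS inE (negPf zs).
Qed.

End Structure.

(** * Labellings *)

(* [LK] is a centre of a star, [LU] a leaf whose centre is still visible,
   [LZ] a vertex none of whose neighbours may be used, [LE] an unused vertex. *)
Inductive label := LE | LU | LK | LZ.

Definition label_code l := match l with LE => 0 | LU => 1 | LK => 2 | LZ => 3 end.
Definition label_decode n := nth LE [:: LE; LU; LK; LZ] n.
Lemma label_codeK : cancel label_code label_decode. Proof. by case. Qed.
HB.instance Definition _ := Equality.copy label (can_type label_codeK).

Definition labels := [:: LE; LU; LK; LZ].

(** Here [c] tells how many neighbours carry each label. A centre may have no leaves at all; in the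
    original graph it then contributes nothing. *)
Definition label_ok (l : label) (c : label -> nat) : bool :=
  match l with
  | LE => true
  | LU => [&& c LU == 0, c LK == 1 & c LZ == 0]
  | LK => (c LK == 0) && (c LZ == 0)
  | LZ => [&& c LU == 0, c LK == 0 & c LZ == 0]
  end.

(* The label of the vertex replacing a prunable pair [u], [v] with labels [x],
   [y]; [b] tells whether the pair is adjacent, [t] whether it is a twin pair. *)
Definition merge_label (b t : bool) (x y : label) : option label :=
  match t, b, x, y with
  | true, _, LE, _ => Some y
  | true, _, _, LE => Some x
  | true, false, LU, LU => Some LU
  | true, false, LU, _ | true, false, _, LU => None
  | true, false, _, _ => Some LZ
  | true, true, LU, LK | true, true, LK, LU => Some LZ
  | true, true, _, _ => None
  | false, true, LE, LU => None
  | false, true, LE, _ => Some LE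
  | false, true, _, LE => Some x
  | false, true, LU, LK => Some LZ
  | false, true, LK, LU => Some LK
  | false, true, _, _ => None
  | false, false, _, LU => None
  | false, false, _, _ => Some x
  end.

Definition label_pairs : seq (label * label) :=
  [seq (x, y) | x <- labels, y <- labels].

Definition merge_pairs b t l :=
  [seq p <- label_pairs | merge_label b t p.1 p.2 == Some l].

Definition merge_weight b t (wu wv : label -> nat) l :=
  foldr maxn 0 [seq wu p.1 + wv p.2 | p <- merge_pairs b t l].

Lemma foldr_maxn_geq (s : seq nat) i : i \in s -> i <= foldr maxn 0 s.
Proof.
elim: s => //= a s IH; rewrite inE leq_max => /orP[/eqP->|/IH->].
  by rewrite leqnn.
by rewrite orbT.
Qed.

Lemma foldr_maxn_mem (s : seq nat) : s != [::] -> foldr maxn 0 s \in s.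
Proof.
elim: s => //= a [|b s] IH _; first by rewrite maxn0 inE.
rewrite inE; case: (leqP a (foldr maxn 0 (b :: s))) => _; last by rewrite eqxx.
by rewrite (IH isT) orbT.
Qed.

Lemma mem_merge_pairs b t l x y :
  ((x, y) \in merge_pairs b t l) = (merge_label b t x y == Some l).
Proof. by rewrite mem_filter /=; case: x; case: y; rewrite andbT. Qed.

Lemma merge_weight_geq b t wu wv l x y :
  merge_label b t x y = Some l -> wu x + wv y <= merge_weight b t wu wv l.
Proof.
move=> /eqP m; apply: foldr_maxn_geq; apply/mapP; exists (x, y) => //.
by rewrite mem_merge_pairs.
Qed.

(** Each label arises from at least one pair, so the default [0] of the fold is never a spurious
    maximum. *)
Lemma merge_weight_attained b t wu wv l :
  exists x y, merge_label b t x y = Some l /\ wu x + wv y = merge_weight b t wu wv l.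
Proof.
have : merge_weight b t wu wv l \in [seq wu p.1 + wv p.2 | p <- merge_pairs b t l].
  by apply: foldr_maxn_mem; case: b; case: t; case: l.
case/mapP => -[x y]; rewrite mem_merge_pairs => /eqP m e.
by exists x, y.
Qed.

(** In this and the next lemmas [r] counts the labels of the neighbours of [u] other than [v]. The
    same counts hold for [v] if the pair is a twin pair; otherwise they are zero. The pairs rejected
    by [merge_label] are those that no [r] makes valid. *)
Lemma merge_feasible b t x y (r : label -> nat) :
  label_ok x (fun l => (b && (y == l)) + r l) ->
  label_ok y (fun l => (b && (x == l)) + (if t then r l else 0)) ->
  merge_label b t x y != None.
Proof.
by case: b; case: t; case: x; case: y => //=; lia.
Qed.

Lemma merge_ok_pair b t x y l (r : label -> nat) :
  merge_label b t x y = Some l -> label_ok l r ->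
  label_ok x (fun l => (b && (y == l)) + r l) &&
  label_ok y (fun l => (b && (x == l)) + (if t then r l else 0)).
Proof.
by case: b; case: t; case: x; case: y => //= -[<-] /=; lia.
Qed.

(** Two nonadjacent twin centres merge into [LZ], although each by itself accepts leaves. The
    condition on [r LU] expresses that a common leaf would see two centres, which is an obstruction
    at the leaf and not at the pair. *)
Lemma merge_ok_merged b t x y l (r : label -> nat) :
  merge_label b t x y = Some l -> (t && (x == LK) && (y == LK) -> r LU = 0) ->
  label_ok x (fun l => (b && (y == l)) + r l) ->
  label_ok y (fun l => (b && (x == l)) + (if t then r l else 0)) ->
  label_ok l r.
Proof.
by case: b; case: t; case: x; case: y => //= -[<-] /=; try lia; move=> /(_ isT); lia.
Qed.

(** A neighbour of [u] with label [z] is counted by [r], so [label_ok l r] restricts [z]. For the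
    labels that remain, the condition does not distinguish the pair from the merged vertex. *)
Lemma merge_ok_other b t x y l (r c : label -> nat) (a : bool) z :
  merge_label b t x y = Some l -> label_ok l r -> (a -> 0 < r z) ->
  label_ok z (fun k => (a && (x == k)) + (t && a && (y == k)) + c k) =
  label_ok z (fun k => (a && (l == k)) + c k).
Proof.
case: a => [|mg _ _]; last by rewrite ?andbF.
move=> mg rl /(_ isT) rz; move: mg rl rz.
by case: b; case: t; case: x; case: y => //= -[<-] /=; case: z => //=; lia.
Qed.

Lemma label_ok_ext l c c' : c =1 c' -> label_ok l c = label_ok l c'.
Proof. by move=> e; case: l; rewrite /= ?e. Qed.

Definition set_label (T : eqType) (f : T -> label) u l :=
  fun x => if x == u then l else f x.

Section Labellings.
Variable G : sgraph.
Implicit Types (A : {set G}) (u v x y z : G) (f g : G -> label).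
Implicit Types (w : G -> label -> nat).

Definition label_count A f x l := \sum_(y in A) (adj x y && (f y == l)).

Definition valid A f := forall x, x \in A -> label_ok (f x) (label_count A f x).

Definition weight A w f := \sum_(x in A) w x (f x).

Definition optimum A w m :=
  (exists2 f, valid A f & weight A w f = m) /\
  (forall f, valid A f -> weight A w f <= m).

Lemma optimum_unique A w m m' : optimum A w m -> optimum A w m' -> m = m'.
Proof.
move=> [[f vf <-] hm] [[g vg <-] hm'].
by apply/eqP; rewrite eqn_leq hm' // hm.
Qed.

Definition merge_weights t u v w : G -> label -> nat :=
  fun x => if x == u then merge_weight (adj u v) t (w u) (w v) else w x.

(** * Merging a prunable pair *)

Section Merge.
Variables (A : {set G}) (t : bool) (u v : G).
Hypothesis puv : prunable A t u v.

Let rest := A :\ v :\ u.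
Let rest_count f x l := \sum_(y in rest) (adj x y && (f y == l)).

Let uA : u \in A. Proof. by case: puv. Qed.
Let vA : v \in A. Proof. by case: puv. Qed.
Let uv : u != v. Proof. by case: puv. Qed.
Let uB : u \in A :\ v. Proof. by rewrite !inE uv uA. Qed.

Lemma in_rest z : (z \in rest) = [&& z != u, z != v & z \in A].
Proof. by rewrite !inE. Qed.

Lemma label_count_split f x l : label_count A f x l =
  (adj x v && (f v == l)) + ((adj x u && (f u == l)) + rest_count f x l).
Proof. by rewrite /label_count (big_setD1 _ vA) (big_setD1 _ uB). Qed.

Lemma rest_count_pruned f l :
  rest_count f v l = if t then rest_count f u l else 0.
Proof.
have [_ _ _ nv] := puv.
have e z : z \in rest -> adj v z = t && adj u z.
  by rewrite in_rest => /and3P[zu zv zA]; apply: nv.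
case: t e => e; first by apply: eq_bigr => z zr; rewrite e.
by apply: big1 => z zr; rewrite e.
Qed.

Variables (f g : G -> label) (l : label).
Hypothesis fgl : merge_label (adj u v) t (f u) (f v) = Some l.
Hypothesis gu : g u = l.
Hypothesis gf : {in rest, g =1 f}.

Let rest_count_eq x k : rest_count g x k = rest_count f x k.
Proof. by apply: eq_bigr => z zr; rewrite gf. Qed.

Let countu k : label_count A f u k = (adj u v && (f v == k)) + rest_count f u k.
Proof. by rewrite label_count_split adj_irrefl. Qed.

Let countv k : label_count A f v k =
  (adj u v && (f u == k)) + (if t then rest_count f u k else 0).
Proof. by rewrite label_count_split adj_irrefl add0n adj_sym rest_count_pruned. Qed.

Let countu' k : label_count (A :\ v) g u k = rest_count f u k.
Proof. by rewrite /label_count (big_setD1 _ uB) /= adj_irrefl -rest_count_eq. Qed.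

Let countz z k : z \in rest -> label_count A f z k =
  (adj z u && (f u == k)) + (t && adj z u && (f v == k)) + rest_count f z k.
Proof.
rewrite in_rest => /and3P[zu zv zA]; have [_ _ _ nv] := puv.
by rewrite label_count_split [adj z v]adj_sym nv // [adj u z]adj_sym addnCA addnA.
Qed.

Let countz' z k : label_count (A :\ v) g z k =
  (adj z u && (l == k)) + rest_count f z k.
Proof. by rewrite /label_count (big_setD1 _ uB) /= gu -rest_count_eq. Qed.

Let visible z : z \in rest -> adj z u -> 0 < rest_count f u (f z).
Proof. by move=> zr zu; rewrite /rest_count (bigD1 z) //= adj_sym zu eqxx. Qed.

Let okz z : label_ok l (rest_count f u) -> z \in rest ->
  label_ok (f z) (label_count A f z) = label_ok (g z) (label_count (A :\ v) g z).
Proof.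
move=> okl zr; rewrite gf //.
rewrite (label_ok_ext _ (fun k => countz k zr)) (label_ok_ext _ (countz' z)).
exact: merge_ok_other fgl okl (visible zr).
Qed.

(** All label counts are expressed through [rest_count], which excludes [u] and [v]; the claim then
    becomes the local lemmas about [merge_label] at [u], at [v] and at the other vertices. *)
Lemma valid_merge : valid A f <-> valid (A :\ v) g.
Proof.
split=> vf.
  have okl : label_ok l (rest_count f u).
    apply: (merge_ok_merged fgl).
    (* A leaf [z] adjacent to [u] is adjacent to the twin [v] as well, and would have two
       centres. *)
    - case/andP=> /andP[t1 /eqP fu] /eqP fv; apply/eqP; rewrite sum_nat_eq0.
      apply/forall_inP => z zr; rewrite eqb0; apply/negP => /andP[uz /eqP fz].
      have zA : z \in A by move: zr; rewrite in_rest => /and3P[].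
      have := vf z zA; rewrite fz (label_ok_ext _ (fun k => countz k zr)) /=.
      by rewrite adj_sym uz t1 fu fv /=; lia.
    - by have := vf u uA; rewrite (label_ok_ext _ countu).
    - by have := vf v vA; rewrite (label_ok_ext _ countv).
  move=> x xB; have [->|xu] := eqVneq x u.
    by rewrite gu (label_ok_ext _ countu').
  have [xv xA] : x != v /\ x \in A by move: xB; rewrite !inE => /andP[].
  by rewrite -okz ?in_rest ?xu ?xv //; apply: vf.
have okl : label_ok l (rest_count f u).
  by have := vf u uB; rewrite gu (label_ok_ext _ countu').
have /andP[ou ov] := merge_ok_pair fgl okl.
move=> x xA; have [->|xu] := eqVneq x u; first by rewrite (label_ok_ext _ countu).
have [->|xv] := eqVneq x v; first by rewrite (label_ok_ext _ countv).
by rewrite okz ?in_rest ?xu ?xv //; apply: vf; rewrite !inE xv.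
Qed.

End Merge.

Lemma valid_mergeable A t u v f : prunable A t u v -> valid A f ->
  merge_label (adj u v) t (f u) (f v) != None.
Proof.
move=> puv vf; have [uA vA _ _] := puv.
apply: (@merge_feasible _ _ _ _ (fun k => \sum_(y in A :\ v :\ u) (adj u y && (f y == k)))).
  rewrite (label_ok_ext _ (_ : _ =1 label_count A f u)); first exact: vf.
  by move=> k; rewrite (label_count_split puv) adj_irrefl.
rewrite (label_ok_ext _ (_ : _ =1 label_count A f v)); first exact: vf.
by move=> k; rewrite (label_count_split puv) adj_irrefl (rest_count_pruned puv) adj_sym.
Qed.

Lemma weight_split A u v w f : u \in A -> v \in A -> u != v ->
  weight A w f = w u (f u) + w v (f v) + weight (A :\ v :\ u) w f.
Proof.
move=> uA vA uv; rewrite /weight (big_setD1 v) //= (big_setD1 u) ?inE ?uv //=.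
by rewrite addnCA addnA.
Qed.

(** An optimal labelling after the deletion is expanded at [u] into a pair attaining the merged
    weight; conversely every valid labelling of [A] merges into one of at least the same weight. *)
Lemma optimum_merge A t u v w m : prunable A t u v ->
  optimum (A :\ v) (merge_weights t u v w) m -> optimum A w m.
Proof.
move=> puv [[g vg mg] maxg]; have [uA vA uv _] := puv.
have vu : v != u by rewrite eq_sym.
have weight' h : weight (A :\ v) (merge_weights t u v w) h =
    merge_weight (adj u v) t (w u) (w v) (h u) + weight (A :\ v :\ u) w h.
  rewrite /weight (big_setD1 u) ?inE ?uv // /merge_weights eqxx; congr (_ + _).
  by apply: eq_bigr => z; rewrite !inE => /andP[/negPf->].
split.
  have [x [y [mxy exy]]] := merge_weight_attained (adj u v) t (w u) (w v) (g u).
  pose f := set_label (set_label g u x) v y.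
  have fu : f u = x by rewrite /f /set_label (negPf uv) eqxx.
  have fv : f v = y by rewrite /f /set_label eqxx.
  have gf : {in A :\ v :\ u, g =1 f}.
    by move=> z; rewrite !inE /f /set_label => /and3P[/negPf-> /negPf->].
  exists f; first by apply/(valid_merge puv _ erefl gf) => //; rewrite fu fv.
  rewrite (weight_split _ _ uA vA uv) fu fv exy -mg weight'; congr (_ + _).
  by apply: eq_bigr => z zr; rewrite gf.
move=> f vf; have := valid_mergeable puv vf.
case ml : merge_label => [l|] // _; pose g' := set_label f u l.
have gu : g' u = l by rewrite /g' /set_label eqxx.
have gf : {in A :\ v :\ u, g' =1 f}.
  by move=> z; rewrite !inE /g' /set_label => /and3P[/negPf->].
have vg' : valid (A :\ v) g' by apply/(valid_merge puv ml gu gf).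
apply: leq_trans (maxg g' vg'); rewrite (weight_split _ _ uA vA uv) weight' gu.
apply: leq_add; first exact: merge_weight_geq.
by apply: eq_leq; apply: eq_bigr => z zr; rewrite gf.
Qed.

(** The label [LU] is missing because a lone vertex cannot see a centre. *)
Definition single_weight (wu : label -> nat) := maxn (wu LE) (maxn (wu LK) (wu LZ)).

Lemma optimum1 u w : optimum [set u] w (single_weight (w u)).
Proof.
have cnt f x l : label_count [set u] f x l = adj x u && (f u == l).
  by rewrite /label_count big_set1.
have wgt f : weight [set u] w f = w u (f u) by rewrite /weight big_set1.
split.
  have [l [lU el]] : exists l, l != LU /\ w u l = single_weight (w u).
    rewrite /single_weight; case: (leqP (w u LK)) => _; case: leqP => _;
      by [exists LE | exists LK | exists LZ].
  exists (fun=> l); last by rewrite wgt.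
  move=> x; rewrite inE => /eqP->; rewrite (label_ok_ext _ (_ : _ =1 fun=> 0)).
    by case: l lU el.
  by move=> k; rewrite cnt adj_irrefl.
move=> f vf; have := vf u; rewrite inE eqxx => /(_ isT).
rewrite (label_ok_ext _ (_ : _ =1 fun=> 0)) => [|k]; last by rewrite cnt adj_irrefl.
by rewrite wgt /single_weight; case: (f u) => //= _; lia.
Qed.

End Labellings.

(** * Packings as labellings *)

Section Packing.
Variable G : sgraph.
Implicit Types (D : {set {set G}}) (f : G -> label) (x y z : G).

Definition rank x : nat := enum_rank x.

Lemma rank_lt x : rank x < #|G|. Proof. exact: ltn_ord. Qed.

Lemma rank_inj : injective rank.
Proof. by move=> x y /val_inj/enum_rank_inj. Qed.

Lemma edge_adj x y : ([set x; y] \in edges G) = adj x y.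
Proof.
rewrite inE; apply/existsP/idP => [[a /existsP[b /andP[ab /eqP e]]]|xy]; last first.
  by exists x; apply/existsP; exists y; rewrite xy eqxx.
have : x \in [set a; b] by rewrite -e !inE eqxx.
have : y \in [set a; b] by rewrite -e !inE eqxx orbT.
have xny : x != y.
  apply: contraTneq ab => exy; have : a \in [set x; y] by rewrite e !inE eqxx.
  have : b \in [set x; y] by rewrite e !inE eqxx orbT.
  by rewrite exy !inE !orbb => /eqP-> /eqP->; rewrite adj_irrefl.
rewrite !inE => /orP[]/eqP ey /orP[]/eqP ex; rewrite ?ex ?ey // ?[adj b a]adj_sym //;
by rewrite ex ey eqxx in xny.
Qed.

Lemma edgeP (e : {set G}) :
  reflect (exists x y, adj x y /\ e = [set x; y]) (e \in edges G).
Proof.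
rewrite inE; apply: (iffP existsP) => [[x /existsP[y /andP[xy /eqP]]]|[x [y [xy ->]]]].
  by exists x, y.
by exists x; apply/existsP; exists y; rewrite xy eqxx.
Qed.

Lemma eopP D : reflect
  ((forall e, e \in D -> e \in edges G) /\
   (forall e1 e2 x y, e1 \in D -> e2 \in D -> e1 != e2 -> x \in e1 -> y \in e2 ->
      adj x y -> [set x; y] = e1 \/ [set x; y] = e2))
  (edge_open_packing D).
Proof.
apply: (iffP andP) => [[/subsetP DE nc]|[DE nc]]; split=> //.
- move=> e1 e2 x y D1 D2 e12 x1 y2 xy.
  have [->|n1] := eqVneq [set x; y] e1; first by left.
  have [->|n2] := eqVneq [set x; y] e2; first by right.
  case/negP: (implyP (forall_inP (forall_inP nc e1 D1) e2 D2) e12).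
  apply/existsP; exists [set x; y].
  rewrite in_setD edge_adj xy in_set2 (negPf n1) (negPf n2) /=.
  by apply/existsP; exists x; rewrite x1; apply/existsP; exists y; rewrite y2 eqxx.
- by apply/subsetP.
- apply/forall_inP => e1 D1; apply/forall_inP => e2 D2; apply/implyP => e12.
  apply/existsPn => e; rewrite !inE; apply/negP => /andP[/andP[ne ee]].
  case/existsP=> x /andP[x1 /existsP[y /andP[y2 /eqP exy]]].
  case/negP: ne; case: (nc e1 e2 x y D1 D2 e12 x1 y2) => [|<-|<-];
    rewrite ?exy ?eqxx ?orbT //.
  by rewrite -edge_adj -exy inE.
Qed.

Lemma label_countE (A : {set G}) f x l :
  label_count A f x l = #|[set y in A | adj x y && (f y == l)]|.
Proof.
rewrite -sum1dep_card /label_count [RHS]big_mkcondr /=.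
by apply: eq_bigr => y _; case: ifP.
Qed.

(** Each edge of a star is charged to its leaf; in a star with a single edge one end plays the
    centre. *)
Definition leaf_weight (x : G) (l : label) : nat := l == LU.

Lemma weight_leaf f : weight setT leaf_weight f = #|[set x | f x == LU]|.
Proof.
rewrite -sum1dep_card /weight [RHS]big_mkcond /=.
by apply: eq_big => [x|x _]; rewrite ?inE // /leaf_weight; case: ifP.
Qed.

Definition centre f x := odflt x [pick y | adj x y && (f y == LK)].

Definition star_edges f := [set [set x; centre f x] | x in [set x | f x == LU]].

(** * From valid labellings to packings *)

Section FromLabelling.
Variable f : G -> label.
Hypothesis vf : valid setT f.

Lemma label_count_neq0 x y l :
  f y = l -> adj x y -> (label_count setT f x l == 0) = false.
Proof.
move=> fy xy; apply/negbTE; rewrite label_countE cards_eq0; apply/set0Pn; exists y.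
by rewrite !inE xy fy eqxx.
Qed.

Lemma leaf_leaf x y : f x = LU -> f y = LU -> ~~ adj x y.
Proof.
move=> fx fy; apply/negP => xy; have := vf (in_setT x).
by rewrite fx /= => /and3P[c _ _]; rewrite (label_count_neq0 fy xy) in c.
Qed.

Lemma centre_centre x y : f x = LK -> f y = LK -> ~~ adj x y.
Proof.
move=> fx fy; apply/negP => xy; have := vf (in_setT x).
by rewrite fx /= => /andP[c _]; rewrite (label_count_neq0 fy xy) in c.
Qed.

Lemma centreP x : f x = LU ->
  [/\ adj x (centre f x), f (centre f x) = LK &
      forall y, adj x y -> f y = LK -> y = centre f x].
Proof.
move=> fx; have := vf (in_setT x); rewrite fx /= => /and3P[_ + _].
rewrite label_countE => /cards1P[k ek].
have kP y : (adj x y && (f y == LK)) = (y == k).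
  by move/setP: ek => /(_ y); rewrite !inE.
have -> : centre f x = k.
  rewrite /centre; case: pickP => [y|/(_ k)]; first by rewrite kP => /eqP.
  by rewrite kP eqxx.
have := kP k; rewrite eqxx => /andP[-> /eqP->]; split=> // y xy fy.
by apply/eqP; rewrite -kP xy fy eqxx.
Qed.

Lemma card_star_edges : #|star_edges f| = weight setT leaf_weight f.
Proof.
rewrite weight_leaf card_in_imset // => x y; rewrite !inE => /eqP fx /eqP fy e.
have : x \in [set y; centre f y] by rewrite -e !inE eqxx.
rewrite !inE => /orP[]/eqP // ex; have [_ + _] := centreP fy.
by rewrite -ex fx.
Qed.

(** Two leaves or two centres are never adjacent, and an edge from a leaf to a centre goes to its
    only centre, so it is one of the two given edges. *)
Lemma star_edges_eop : edge_open_packing (star_edges f).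
Proof.
apply/eopP; split=> [e /imsetP[x]|e1 e2 p q].
  by rewrite inE => /eqP fx ->; rewrite edge_adj; have [] := centreP fx.
case/imsetP=> x; rewrite inE => /eqP fx -> /imsetP[y]; rewrite inE => /eqP fy -> _.
have [xc cx ux] := centreP fx; have [yc cy uy] := centreP fy.
rewrite !inE => /orP[]/eqP-> /orP[]/eqP-> pq.
- by rewrite (negPf (leaf_leaf fx fy)) in pq.
- by left; rewrite -(ux _ pq cy).
- by right; rewrite adj_sym in pq; rewrite -(uy _ pq cx) setUC.
- by rewrite (negPf (centre_centre cx cy)) in pq.
Qed.

End FromLabelling.

(** * From packings to valid labellings *)

Section FromPacking.
Variable D : {set {set G}}.
Hypothesis eopD : edge_open_packing D.

Let S := cover D.
Let H x y := [&& x \in S, y \in S & adj x y].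
Let deg x := #|[set y | H x y]|.
(** Lexicographic order by degree in [H], then by rank: the rank breaks the tie between the ends of
    an isolated edge, exactly one of which must become the centre. *)
Let key x := deg x * #|G| + rank x.

(** An edge joining two different packed edges must be one of them, and an edge inside a single
    packed edge is that edge; so the covered vertices induce no edges outside [D]. *)
Lemma packing_adj x y : H x y -> [set x; y] \in D.
Proof.
case/and3P=> /bigcupP[e1 D1 x1] /bigcupP[e2 D2 y2] xy.
have [DE nc] := eopP _ eopD; have [e12|e12] := eqVneq e1 e2; last first.
  by case: (nc e1 e2 x y D1 D2 e12 x1 y2 xy) => ->.
suff -> : [set x; y] = e1 by [].
have /edgeP[a [b [ab e1ab]]] := DE _ D1; rewrite -e12 in y2.
have xny : x != y by apply: contraTneq xy => ->; rewrite adj_irrefl.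
apply/eqP; rewrite eqEcard subUset !sub1set x1 y2 cards2 xny e1ab cards2.
by case: (_ != _).
Qed.

Lemma H_sym x y : H x y = H y x.
Proof. by rewrite /H adj_sym andbCA. Qed.

Lemma deg_gt1 x y : 1 < deg x -> exists2 z, H x z & z != y.
Proof.
case/card_gt1P=> a [b []]; rewrite !inE => xa xb ab.
by have [ay|] := eqVneq a y; [exists b; rewrite // -ay eq_sym | exists a].
Qed.

(** Further edges [ab] and [cd] would conflict through [bc]. The vertices [a] and [d] may coincide,
    so triangles are excluded too, and the components of [H] are stars. *)
Lemma no_path3 b c : H b c -> 1 < deg b -> 1 < deg c -> False.
Proof.
move=> bc /(@deg_gt1 _ c)[a ba ac] /(@deg_gt1 _ b)[d cd db].
have adjH x y : H x y -> x != y.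
  by case/and3P=> _ _; apply: contraTneq => ->; rewrite adj_irrefl.
have [DE nc] := eopP _ eopD.
have eqset (x y z t : G) : [set x; y] = [set z; t] -> (x == z) || (x == t).
  by move=> e; have : x \in [set z; t]; [rewrite -e !inE eqxx | rewrite !inE].
have bca : [set b; c] <> [set a; b].
  rewrite [[set b; c]]setUC => /eqset; rewrite [c == a]eq_sym (negPf ac) /=.
  by rewrite eq_sym (negPf (adjH _ _ bc)).
have bcd : [set b; c] <> [set c; d].
  by move/eqset; rewrite (negPf (adjH _ _ bc)) eq_sym (negPf db).
have ne : [set a; b] != [set c; d].
  apply/eqP => e; move: (e); rewrite [[set a; b]]setUC => /eqset.
  by rewrite (negPf (adjH _ _ bc)) eq_sym (negPf db).
have ab : H a b by rewrite H_sym.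
have bcG : adj b c by case/and3P: bc.
case: (nc _ _ b c (packing_adj ab) (packing_adj cd) ne) => //; by rewrite !inE eqxx ?orbT.
Qed.

Lemma key_deg x y : key x <= key y -> deg x <= deg y.
Proof.
rewrite /key; move: (rank_lt y); move: (rank x) (rank y) (deg x) (deg y) #|G|.
by move=> rx ry dx dy n; nia.
Qed.

Lemma key_inj : injective key.
Proof.
move=> x y e; have d : deg x = deg y by apply/eqP; rewrite eqn_leq !key_deg ?e.
by apply: rank_inj; move: e; rewrite /key d => /addnI.
Qed.

(* Of the two ends of an edge, the one with more packed edges is the centre. *)
Definition packing_label x : label :=
  if x \notin S then LE else if [forall y, H x y ==> (key y < key x)] then LK else LU.

Let f := packing_label.

Lemma label_leaf x : f x = LU -> exists2 y, H x y & key x <= key y.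
Proof.
rewrite /f /packing_label; case: ifP => // _; case: ifP => // /negbT/forallPn[y].
by rewrite negb_imply -leqNgt => /andP[xy k] _; exists y.
Qed.

Lemma label_centre x y : f x = LK -> H x y -> key y < key x.
Proof.
rewrite /f /packing_label; case: ifP => // _; case: ifP => // /forallP/(_ y)/implyP h _.
exact: h.
Qed.

Lemma label_notE x : x \in S -> f x = LK \/ f x = LU.
Proof. by rewrite /f /packing_label => ->; case: ifP; [left|right]. Qed.

Lemma label_support x : f x != LE -> x \in S.
Proof. by rewrite /f /packing_label; case: (x \in S). Qed.

Lemma label_notZ x : f x != LZ.
Proof. by rewrite /f /packing_label; case: ifP => // _; case: ifP. Qed.

Lemma label_H x y : f x != LE -> f y != LE -> adj x y -> H x y.
Proof. by move=> /label_support xS /label_support yS xy; apply/and3P. Qed.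

Lemma label_KK x y : f x = LK -> f y = LK -> ~~ adj x y.
Proof.
move=> fx fy; apply/negP => xy; have xy' : H x y by rewrite label_H ?fx ?fy.
have := label_centre fx xy'; rewrite H_sym in xy'; have := label_centre fy xy'.
by lia.
Qed.

(** Of two adjacent leaves let [b] have the larger key. Being a leaf, [b] has a neighbour [c] of no
    smaller key, and [c] is not the other leaf since keys are injective. So [b] has degree at least
    two, hence [c] as well, against [no_path3]. *)
Lemma label_UU x y : f x = LU -> f y = LU -> ~~ adj x y.
Proof.
have half a b : f a = LU -> f b = LU -> adj a b -> key a <= key b -> False.
  move=> fa fb ab kab; have ab' : H a b by rewrite label_H ?fa ?fb.
  have [c bc kbc] := label_leaf fb.
  have ac : a != c.
    apply: contraTneq ab => eac; have -> : a = b.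
      by apply: key_inj; move: kbc; rewrite -eac; lia.
    by rewrite adj_irrefl.
  have db : 1 < deg b.
    by apply/card_gt1P; exists a, c; rewrite !inE bc H_sym ab'.
  by apply: (no_path3 bc db); apply: leq_trans db _; apply: key_deg.
move=> fx fy; apply/negP => xy; have [k|/ltnW k] := leqP (key x) (key y).
  exact: (half x y).
by apply: (half y x) => //; rewrite adj_sym.
Qed.

Lemma label_unique_neighbour x y z : f x = LU -> H x y -> H x z -> y = z.
Proof.
move=> fx xy xz; apply/eqP; apply: contraT => yz.
have [c xc kxc] := label_leaf fx.
have dx : 1 < deg x by apply/card_gt1P; exists y, z; rewrite !inE.
by case: (no_path3 xc dx); apply: leq_trans dx _; apply: key_deg.
Qed.

Lemma packing_label_valid : valid setT f.
Proof.
have count0 x l : (forall y, f y = l -> ~~ adj x y) -> label_count setT f x l == 0.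
  move=> no; rewrite label_countE cards_eq0; apply/eqP/setP => y; rewrite !inE.
  by have [/no/negPf->|] := eqVneq (f y) l; rewrite ?andbF.
move=> x _; have cZ : label_count setT f x LZ == 0.
  by apply: count0 => y fy; move: (label_notZ y); rewrite fy.
case fx: (f x) => //=; rewrite cZ ?andbT.
- rewrite count0 => [|y fy] /=; last exact: label_UU.
  have [y xy _] := label_leaf fx; rewrite label_countE; apply/cards1P; exists y.
  have [xS yS axy] := and3P xy.
  apply/setP => z; rewrite !inE /=; apply/andP/eqP => [[xz /eqP fz]|->].
    by apply: (label_unique_neighbour fx _ xy); apply: label_H; rewrite ?fx ?fz.
  split=> //; case: (label_notE yS) => [->//|fy].
  by have := label_UU fx fy; rewrite axy.
- by apply: count0 => y fy; apply: label_KK.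
- by move: (label_notZ x); rewrite fx.
Qed.

Lemma packing_label_weight : #|D| <= weight setT leaf_weight f.
Proof.
rewrite -card_star_edges; last exact: packing_label_valid.
apply: subset_leq_card; apply/subsetP => e De; have [DE _] := eopP _ eopD.
have /edgeP[x [y [xy exy]]] := DE e De.
have inS z : z \in e -> z \in S by move=> ze; apply/bigcupP; exists e.
have xS : x \in S by rewrite inS // exy !inE eqxx.
have yS : y \in S by rewrite inS // exy !inE eqxx orbT.
have star a b : adj a b -> f a = LU -> f b = LK -> [set a; b] \in star_edges f.
  move=> ab fa fb; apply/imsetP; exists a; rewrite ?inE ?fa //.
  by have [_ _ /(_ b ab fb)->] := centreP packing_label_valid fa.
rewrite exy; case: (label_notE xS) => fx; case: (label_notE yS) => fy.
- by have := label_KK fx fy; rewrite xy.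
- by rewrite setUC; apply: star; rewrite // adj_sym.
- exact: star.
- by have := label_UU fx fy; rewrite xy.
Qed.

End FromPacking.

Theorem eop_optimum : optimum setT leaf_weight (eop_number G).
Proof.
have ub f : valid setT f -> weight setT leaf_weight f <= eop_number G.
  move=> vf; rewrite -(card_star_edges vf) /eop_number.
  exact: (leq_bigmax_cond _ (star_edges_eop vf)).
split=> //; have eop0 : edge_open_packing (set0 : {set {set G}}).
  by apply/eopP; split=> ?; rewrite inE.
have ne : 0 < #|[pred D : {set {set G}} | edge_open_packing D]|.
  by apply/card_gt0P; exists set0.
have [D eD cD] := eq_bigmax_cond (fun D : {set {set G}} => #|D|) ne.
exists (packing_label D); first exact: packing_label_valid.
apply/eqP; rewrite eqn_leq ub /=; last exact: packing_label_valid.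
by rewrite /eop_number cD packing_label_weight.
Qed.

End Packing.

(** * Running programs *)

(** Evaluation without regard to the word length. Overflow is checked separately by [fits], which
    keeps functional correctness and size bounds apart. *)
Fixpoint value (s : state) (e : expr) : nat :=
  match e with
  | Defs.Num k => k
  | Reg r => regs s r
  | Fetch a => cells s (value s a)
  | Op o e1 e2 => eval_op o (value s e1) (value s e2)
  end.

Fixpoint straight_cost (c : cmd) : nat :=
  match c with
  | SetReg _ e => (cost e).+1
  | Store a e => (cost a + cost e).+1
  | Seq c1 c2 => straight_cost c1 + straight_cost c2
  | If e c1 c2 => (cost e + maxn (straight_cost c1) (straight_cost c2)).+1
  | _ => 1
  end.

Definition set_reg (s : state) r v := State (update (regs s) r v) (cells s).
Definition set_cell (s : state) i v := State (regs s) (update (cells s) i v).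

Definition For r b body :=
  Seq (SetReg r (Defs.Num 0))
      (While (Op OpLeq (Op OpAdd (Reg r) (Defs.Num 1)) (Reg b))
             (Seq body (SetReg r (Op OpAdd (Reg r) (Defs.Num 1))))).

Section Runs.
Variable w : nat.

Fixpoint fits (s : state) (e : expr) : bool :=
  match e with
  | Defs.Num k => k < 2 ^ w
  | Reg r => regs s r < 2 ^ w
  | Fetch a => fits s a && (cells s (value s a) < 2 ^ w)
  | Op o e1 e2 =>
      [&& fits s e1, fits s e2 & eval_op o (value s e1) (value s e2) < 2 ^ w]
  end.

Lemma eval_fits s e : fits s e -> eval w s e = Some (value s e).
Proof.
elim: e => [k|r|a IH|o e1 IH1 e2 IH2] /=; rewrite /word.
- by move->.
- by move->.
- by case/andP=> /IH-> ->.
- by case/and3P=> /IH1-> /IH2-> ->.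
Qed.

(** Total correctness within time [t]. The postcondition of one command may itself be a [runs]
    statement, which is how sequences are treated. *)
Definition runs c s t (Q : state -> Prop) :=
  exists t' s', [/\ exec w c s t' s', t' <= t & Q s'].

Lemma runs_weaken c s t t' (Q Q' : state -> Prop) :
  runs c s t Q -> t <= t' -> (forall s', Q s' -> Q' s') -> runs c s t' Q'.
Proof.
move=> [t0 [s0 [ex le q]]] le' QQ'; exists t0, s0; split=> //; last exact: QQ'.
exact: leq_trans le le'.
Qed.

Lemma runs_skip s (Q : state -> Prop) : Q s -> runs Skip s 1 Q.
Proof. by exists 1, s; split=> //; constructor. Qed.

Lemma runs_set r e s (Q : state -> Prop) :
  fits s e -> Q (set_reg s r (value s e)) -> runs (SetReg r e) s (cost e).+1 Q.
Proof.
move=> fe q; exists (cost e).+1, (set_reg s r (value s e)); split=> //.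
by constructor; apply: eval_fits.
Qed.

Lemma runs_store a e s (Q : state -> Prop) :
  fits s a -> fits s e -> Q (set_cell s (value s a) (value s e)) ->
  runs (Store a e) s (cost a + cost e).+1 Q.
Proof.
move=> fa fe q; exists (cost a + cost e).+1, (set_cell s (value s a) (value s e)).
by split=> //; constructor; apply: eval_fits.
Qed.

Lemma runs_seq c1 c2 s t1 t2 (Q : state -> Prop) :
  runs c1 s t1 (fun s' => runs c2 s' t2 Q) -> runs (Seq c1 c2) s (t1 + t2) Q.
Proof.
move=> [t [s1 [ex1 le1 [t' [s2 [ex2 le2 q]]]]]]; exists (t + t'), s2.
by split=> //; [apply: ExecSeq ex1 ex2 | apply: leq_add].
Qed.

Lemma runs_if e c1 c2 s t1 t2 (Q : state -> Prop) :
  fits s e ->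
  (value s e != 0 -> runs c1 s t1 Q) -> (value s e = 0 -> runs c2 s t2 Q) ->
  runs (If e c1 c2) s (cost e + maxn t1 t2).+1 Q.
Proof.
move=> fe r1 r2; have ev := eval_fits fe.
have [v0|v0] := eqVneq (value s e) 0.
  have [t [s' [ex le q]]] := r2 v0; exists (cost e + t).+1, s'; split=> //.
    by apply: ExecIf ev _; rewrite v0.
  by rewrite ltnS leq_add2l leq_max le orbT.
have [t [s' [ex le q]]] := r1 v0; exists (cost e + t).+1, s'; split=> //.
  by apply: ExecIf ev _; rewrite v0.
by rewrite ltnS leq_add2l leq_max le.
Qed.

(** Besides the body a round costs 5 for the test, 1 for the loop and 4 for the increment; the
    initialisation costs 2 and the last, failing test 6. The bound on [N.+1] is needed because the
    last test computes [N + 1]. *)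
Lemma runs_for r b body s N T (I : nat -> state -> Prop) (Q : state -> Prop) :
  N.+1 < 2 ^ w ->
  I 0 (set_reg s r 0) ->
  (forall i s, i <= N -> I i s -> regs s r = i /\ regs s b = N) ->
  (forall i s, i < N -> I i s ->
     runs body s T (fun s' => regs s' r = i /\ I i.+1 (set_reg s' r i.+1))) ->
  (forall s, I N s -> Q s) ->
  runs (For r b body) s (N * (T + 10) + 8) Q.
Proof.
move=> Nw I0 Ir Ib IQ.
have small k : k <= N.+1 -> k < 2 ^ w by move=> kN; apply: leq_ltn_trans Nw.
have loop j : forall i s, i + j = N -> I i s ->
  runs (While (Op OpLeq (Op OpAdd (Reg r) (Defs.Num 1)) (Reg b))
             (Seq body (SetReg r (Op OpAdd (Reg r) (Defs.Num 1))))) s (j * (T + 10) + 6) Q.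
  elim: j => [|j IH] i s1 ij Is.
    have iN : i <= N by lia.
    have [sr sb] := Ir i s1 iN Is.
    have ev : eval w s1 (Op OpLeq (Op OpAdd (Reg r) (Defs.Num 1)) (Reg b)) = Some 0.
      rewrite eval_fits /= sr sb; first by congr Some; lia.
      by rewrite !small //; lia.
    exists 6, s1; split; [exact: (ExecWhileStop _ ev)|lia|].
    by apply: IQ; rewrite addn0 in ij; rewrite -ij.
  have iN : i <= N by lia.
  have [sr sb] := Ir i s1 iN Is.
  have ev : eval w s1 (Op OpLeq (Op OpAdd (Reg r) (Defs.Num 1)) (Reg b)) = Some 1.
    rewrite eval_fits /= sr sb; first by congr Some; lia.
    by rewrite !small //; lia.
  have [|t1 [s2 [ex1 le1 [rs2 Is2]]]] := Ib i s1 _ Is; first lia.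
  have [|t2 [s3 [ex2 le2 q]]] := IH i.+1 _ _ Is2; first lia.
  have exr : exec w (SetReg r (Op OpAdd (Reg r) (Defs.Num 1))) s2 4 (set_reg s2 r i.+1).
    apply: (ExecSetReg r); rewrite eval_fits /= rs2 ?addn1 //.
    by rewrite !small //; lia.
  exists (5 + (t1 + 4) + t2).+1, s3; split=> //; last by rewrite mulSn; lia.
  exact: (ExecWhileLoop ev _ (ExecSeq ex1 exr) ex2).
rewrite (_ : N * (T + 10) + 8 = 2 + (N * (T + 10) + 6)); last lia.
apply: runs_seq; apply: (@runs_set r (Defs.Num 0)); first exact: small.
by apply: loop I0; rewrite add0n.
Qed.

Fixpoint straight (c : cmd) (s : state) : state :=
  match c with
  | SetReg r e => set_reg s r (value s e)
  | Store a e => set_cell s (value s a) (value s e)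
  | Seq c1 c2 => straight c2 (straight c1 s)
  | If e c1 c2 => if value s e != 0 then straight c1 s else straight c2 s
  | _ => s
  end.

Fixpoint straight_fits (c : cmd) (s : state) : bool :=
  match c with
  | Skip => true
  | SetReg r e => fits s e
  | Store a e => fits s a && fits s e
  | Seq c1 c2 => straight_fits c1 s && straight_fits c2 (straight c1 s)
  | If e c1 c2 => fits s e &&
      (if value s e != 0 then straight_fits c1 s else straight_fits c2 s)
  | While _ _ => false
  end.

Lemma runs_straight c s (Q : state -> Prop) :
  straight_fits c s -> Q (straight c s) -> runs c s (straight_cost c) Q.
Proof.
elim: c s Q => [|r e|a e|c1 IH1 c2 IH2|e c1 IH1 c2 IH2|//] s Q /=.
- by move=> _; apply: runs_skip.
- exact: runs_set.
- by case/andP; apply: runs_store.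
- by case/andP=> f1 f2 q; apply/runs_seq/IH1 => //; apply: IH2.
- case/andP=> fe; case: ifP => v f12 q; apply: runs_if => //.
  + by move=> _; apply: IH1.
  + by move=> v0; rewrite v0 in v.
  + by rewrite v.
  + by move=> _; apply: IH2.
Qed.

End Runs.

(** * The program *)

(* The memory is read as a matrix with rows of length [n]: rows [0 .. n - 1] are
   the adjacency matrix, row [n] is zero, row [n + 1 + i] counts in column [j]
   the remaining vertices on which the rows [i] and [j] differ, row [2 n + 2]
   marks the remaining vertices, and row [2 n + 3 + k] holds the weights of the
   [k]-th label.  Since row [n] is zero, row [2 n + 1] holds the degrees.
   Registers 0, 7, 8 contain [n], [n + 1], [n - 1]; registers 3, 4, 5 receive the
   pair [u], [v] to be merged and its kind; registers 10-13 and 14-17 receive the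
   weights of [u] and of [v]; the others are loop counters. *)
Definition address i j := Op OpAdd (Op OpMul i (Reg 0)) j.
Definition cell i j := Fetch (address i j).

Definition entry n s i j := cells s (i * n + j).

Lemma eqn_row_col n i j i' j' : j < n -> j' < n ->
  (i' * n + j' == i * n + j) = (i' == i) && (j' == j).
Proof.
move=> jn jn'; apply/eqP/andP => [e|[/eqP-> /eqP->]] //; have n0 : 0 < n by lia.
have := congr1 (divn^~ n) e; have := congr1 (modn^~ n) e.
by rewrite !modnMDl !divnMDl // !modn_small // !divn_small // !addn0 => -> ->.
Qed.

Lemma entry_set_cell n s i j k i' j' : j < n -> j' < n ->
  entry n (set_cell s (i * n + j) k) i' j' =
  if (i' == i) && (j' == j) then k else entry n s i' j'.
Proof.
by move=> jn jn'; rewrite /entry /set_cell /= /update eqn_row_col.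
Qed.

Definition count_row i := Op OpAdd (Reg 7) i.
Definition alive_row := Op OpAdd (Reg 7) (Reg 7).
Definition weight_row k := Op OpAdd alive_row (Defs.Num k.+1).

Definition difference :=
  Op OpSub (Defs.Num 1) (Op OpEq (cell (Reg 1) (Reg 4)) (cell (Reg 2) (Reg 4))).

Definition new_count o := Op o (cell (count_row (Reg 1)) (Reg 2)) difference.

Definition update_entry o :=
  Store (address (count_row (Reg 1)) (Reg 2)) (new_count o).

(* Accounts for the insertion ([OpAdd]) or the deletion ([OpSub]) of the vertex
   in register 4. *)
Definition update_counts o := For 1 7 (For 2 0 (update_entry o)).

Definition mark_alive :=
  Seq (Store (address alive_row (Reg 4)) (Defs.Num 1))
      (Store (address (weight_row 1) (Reg 4)) (Defs.Num 1)).

Definition initialise := For 4 0 (Seq (update_counts OpAdd) mark_alive).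

Definition candidate :=
  Op OpMul (Op OpMul (cell alive_row (Reg 1)) (cell alive_row (Reg 2)))
           (Op OpSub (Defs.Num 1) (Op OpEq (Reg 1) (Reg 2))).

(** Adjacent twins differ exactly in their own two columns, which gives the target [a + a]. For a
    pendant vertex the other row is the zero row, whose index [n] is the content of register 0; only
    the column of the first vertex may then differ, which gives the target [a]. *)
Definition prune_test (t : bool) :=
  let a := cell (Reg 1) (Reg 2) in
  Op OpMul candidate
    (Op OpEq (cell (count_row (Reg (if t then 1 else 0))) (Reg 2))
             (if t then Op OpAdd a a else a)).

Definition select t :=
  Seq (SetReg 3 (Reg 1)) (Seq (SetReg 4 (Reg 2)) (SetReg 5 (Defs.Num t))).

Definition search_entry :=
  If (prune_test true) (select 1) (If (prune_test false) (select 0) Skip).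

Definition search := For 1 0 (For 2 0 search_entry).

(** A maximum, since subtraction is truncated at zero. *)
Definition max_expr a b := Op OpAdd a (Op OpSub b a).

Definition merge_expr b t l : expr :=
  foldr max_expr (Defs.Num 0)
    [seq Op OpAdd (Reg (10 + label_code p.1)) (Reg (14 + label_code p.2))
    | p <- merge_pairs b t l].

Definition sequence : seq cmd -> cmd := foldr Seq Skip.

Definition load_weight r v l :=
  SetReg (r + label_code l) (cell (weight_row (label_code l)) (Reg v)).

Definition store_weight b t l :=
  Store (address (weight_row (label_code l)) (Reg 3)) (merge_expr b t l).

Definition load_weights r v := sequence [seq load_weight r v l | l <- labels].

Definition store_weights b t := sequence [seq store_weight b t l | l <- labels].

Definition merge_selected :=
  Seq (load_weights 10 3) (Seq (load_weights 14 4)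
  (If (cell (Reg 3) (Reg 4))
    (If (Reg 5) (store_weights true true) (store_weights true false))
    (If (Reg 5) (store_weights false true) (store_weights false false)))).

Definition prune :=
  Seq search (Seq merge_selected
  (Seq (Store (address alive_row (Reg 4)) (Defs.Num 0)) (update_counts OpSub))).

Definition answer_expr :=
  max_expr (cell (weight_row (label_code LE)) (Reg 3))
           (max_expr (cell (weight_row (label_code LK)) (Reg 3))
                     (cell (weight_row (label_code LZ)) (Reg 3))).

Definition answer := If (Reg 0) (SetReg 0 answer_expr) Skip.

(** After [n - 1] rounds one vertex is left, and register 3 holds it because it receives the
    surviving member of each merged pair. If [n = 1], its initial value 0 is the rank of the only
    vertex. *)
Definition eop_program :=
  Seq (SetReg 7 (Op OpAdd (Reg 0) (Defs.Num 1)))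
  (Seq (SetReg 8 (Op OpSub (Reg 0) (Defs.Num 1)))
  (Seq initialise (Seq (For 6 8 prune) answer))).

(** * Absence of overflow and the update of the difference table *)

Section Bounds.
Variables n w : nat.
Hypothesis wide : 16 * n.+2 ^ 2 <= 2 ^ w.

Lemma small k : k <= 2 * n + 8 -> k < 2 ^ w.
Proof. by move=> kn; apply: leq_trans wide; rewrite expnS expn1; nia. Qed.

Lemma fits_address s i j : regs s 0 = n ->
  fits w s i -> fits w s j -> value s i <= 2 * n + 6 -> value s j <= n ->
  fits w s (address i j).
Proof.
rewrite /= => -> -> -> ib jb; rewrite small //=; last lia.
have W : 16 * (n.+2 * n.+2) <= 2 ^ w by rewrite mulnn.
by apply/andP; split; (apply: leq_trans W; nia).
Qed.

Lemma value_address s i j : regs s 0 = n ->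
  value s (address i j) = value s i * n + value s j.
Proof. by move=> /= ->. Qed.

Lemma value_cell s i j : regs s 0 = n ->
  value s (cell i j) = entry n s (value s i) (value s j).
Proof. by move=> /= ->. Qed.

Lemma fits_cell s i j : regs s 0 = n ->
  fits w s i -> fits w s j -> value s i <= 2 * n + 6 -> value s j <= n ->
  entry n s (value s i) (value s j) <= 2 * n + 8 -> fits w s (cell i j).
Proof.
move=> s0 fi fj bi bj bm; rewrite /cell.
have fa := fits_address s0 fi fj bi bj.
by rewrite -[fits w s _]/(fits w s (address i j) && _) fa value_address // small.
Qed.

Lemma merge_exprP s b t l wu wv :
  (forall k, regs s (10 + label_code k) = wu k) ->
  (forall k, regs s (14 + label_code k) = wv k) ->
  (forall x y, wu x + wv y <= n) ->
  [/\ fits w s (merge_expr b t l),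
      value s (merge_expr b t l) = merge_weight b t wu wv l &
      merge_weight b t wu wv l <= n].
Proof.
move=> su sv uvn; rewrite /merge_expr /merge_weight.
elim: (merge_pairs b t l) => [|[x y] ps [f e le]] /=; first by split=> //; apply: small; lia.
have uv := uvn x y; have sm k : k <= n -> k < 2 ^ w by move=> kn; apply: small; lia.
rewrite !(su x) !(sv y) e f /= -maxnE !sm ?geq_max ?uv ?le //; lia.
Qed.

Lemma fits_new_count o s :
  fits w s (cell (count_row (Reg 1)) (Reg 2)) -> fits w s difference ->
  value s (new_count o) < 2 ^ w -> fits w s (new_count o).
Proof. by move=> f1 f2 lt; apply/and3P. Qed.

Opaque address cell new_count merge_expr.

Definition same_regs (rs : seq nat) s s' :=
  forall r, r \notin rs -> regs s' r = regs s r.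

Lemma same_regs_set rs s s' r v :
  same_regs rs s s' -> r \in rs -> same_regs rs s (set_reg s' r v).
Proof.
move=> ss rr q qn; rewrite /= /update; case: eqP => [qr|_]; last exact: ss.
by rewrite qr rr in qn.
Qed.

Definition bounded_mem s :=
  forall i j, i <= 2 * n + 6 -> j < n -> entry n s i j <= n.

Definition updated o s v i j :=
  if n < i <= 2 * n + 1
  then eval_op o (entry n s i j) (entry n s (i - n.+1) v != entry n s j v)
  else entry n s i j.

(** Insertion and deletion cost the same, so [OpAdd] stands for both. *)
Definition update_time := n.+1 * (n * (straight_cost (update_entry OpAdd) + 10) + 8 + 10) + 8.

Lemma runs_update o s v (Q : state -> Prop) : o = OpAdd \/ o = OpSub ->
  regs s 0 = n -> regs s 7 = n.+1 -> regs s 4 = v -> v < n -> bounded_mem s ->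
  (forall s', same_regs [:: 1; 2] s s' ->
     (forall i j, j < n -> entry n s' i j = updated o s v i j) -> Q s') ->
  runs w (update_counts o) s update_time Q.
Proof.
move=> oP s0 s7 s4 vn bs HQ.
(* The memory when [x] rows of the table and the first [y] entries of the next one are updated. The
   adjacency rows and the zero row are only read. *)
pose mixed x y i j := if (n < i) && ((i < n.+1 + x) || ((i == n.+1 + x) && (j < y)))
  then updated o s v i j else entry n s i j.
pose good x y s' := same_regs [:: 1; 2] s s' /\
  forall i j, j < n -> entry n s' i j = mixed x y i j.
apply: (@runs_for _ _ _ _ _ n.+1 _ (fun x s' => regs s' 1 = x /\ good x 0 s')).
- by apply: small; lia.
- split=> //; split=> [|i j jn]; first exact: same_regs_set.
  by rewrite /mixed ltn0 andbF orbF; case: ifP => //; lia.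
- by move=> x s' xn [s1 [reg _]]; split=> //; rewrite reg.
- move=> x s1 xn [s1x [reg1 mem1]].
  apply: (@runs_for _ _ _ _ _ n _ (fun y s' => [/\ regs s' 1 = x, regs s' 2 = y & good x y s'])).
  + by apply: small; lia.
  + by split=> //; split=> //; apply: same_regs_set.
  + by move=> y s' yn [_ s2 [reg _]]; split=> //; rewrite reg.
  + move=> y s2 yn [r1 r2 [reg2 mem2]].
    have r0 : regs s2 0 = n by rewrite reg2.
    have r7 : regs s2 7 = n.+1 by rewrite reg2.
    have r4 : regs s2 4 = v by rewrite reg2.
    have mxy : entry n s2 (n.+1 + x) y = entry n s (n.+1 + x) y.
      by rewrite mem2 // /mixed; case: ifP => //; lia.
    have madj i : i <= n -> entry n s2 i v = entry n s i v.
      by move=> iN; rewrite mem2 // /mixed; case: ifP => //; lia.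
    have bxy : entry n s (n.+1 + x) y <= n by apply: bs; lia.
    have badj i : i <= n -> entry n s i v <= n by move=> iN; apply: bs; lia.
    have vx : value s2 (count_row (Reg 1)) = n.+1 + x by rewrite /= r7 r1.
    have fx : fits w s2 (count_row (Reg 1)).
      by rewrite /= r7 r1 !small //; lia.
    have f1 : fits w s2 (Reg 1) by rewrite /= r1 small //; lia.
    have f2 : fits w s2 (Reg 2) by rewrite /= r2 small //; lia.
    have f4 : fits w s2 (Reg 4) by rewrite /= r4 small //; lia.
    set d : nat := entry n s x v != entry n s y v.
    have vd : value s2 difference = d.
      rewrite -[LHS]/(1 - (value s2 (cell (Reg 1) (Reg 4)) == value s2 (cell (Reg 2) (Reg 4)))).
      by rewrite !value_cell //= r1 r2 r4 !madj; try lia.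
    have ve : value s2 (new_count o) = eval_op o (entry n s (n.+1 + x) y) d.
      by rewrite -vd -mxy -vx -r2 -(value_cell _ (Reg 2)).
    (* Only the bound [n] on old entries is known here, so an increment is bounded by [n.+1], which
       still fits. *)
    have be : eval_op o (entry n s (n.+1 + x) y) d <= n.+1.
      have d1 : d <= 1 by rewrite /d; case: (_ != _).
      by case: oP => ->; rewrite /eval_op; lia.
    have fe : fits w s2 (new_count o).
      apply: fits_new_count; last by rewrite ve small //; lia.
        by apply: fits_cell; rewrite // ?vx /= ?r2 ?mxy; lia.
      have c1 : fits w s2 (cell (Reg 1) (Reg 4)).
        by apply: fits_cell; rewrite //= ?r1 ?r4 ?madj; try lia; have := badj x; lia.
      have c2 : fits w s2 (cell (Reg 2) (Reg 4)).
        by apply: fits_cell; rewrite //= ?r2 ?r4 ?madj; try lia; have := badj y; lia.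
      apply/and3P; split; first by apply: small; lia.
        by apply/and3P; split=> //; apply: small; rewrite /eval_op; case: (_ == _); lia.
      have d2 : d <= 2 * n + 8 by rewrite /d; case: (_ != _); lia.
      by move: d2; rewrite -vd => d2; apply: small; apply: leq_trans d2 _.
    apply: runs_weaken (_ : _ <= _) (fun s' h => h).
      apply: (@runs_straight _ (update_entry o)).
        by rewrite /= fe andbT; apply: fits_address; rewrite // ?vx /= ?r2; lia.
      split=> //; rewrite /= value_address // vx ve; split=> //=; split=> [|i j jn].
        exact: same_regs_set.
      rewrite -[LHS]/(entry n (set_cell s2 ((n.+1 + x) * n + regs s2 2) (eval_op o (entry n s (n.+1 + x) y) d)) i j).
      rewrite r2 entry_set_cell // mem2 // /mixed.
      case: ifP => [/andP[/eqP-> /eqP->]|ne].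
        rewrite (_ : (n < n.+1 + x) && _ = true); last by lia.
        by rewrite /updated (_ : n < n.+1 + x <= 2 * n + 1 = true) ?addKn //; lia.
      by congr (if _ then _ else _); lia.
    by case: oP => ->.
  + move=> s' [r1 _ [reg' entry']]; split=> //; split=> //; split.
      exact: same_regs_set.
    move=> i j jn; rewrite -[LHS]/(entry n s' i j) entry' // /mixed.
    by congr (if _ then _ else _); rewrite jn; lia.
move=> s' [_ [reg' entry']]; apply: HQ => // i j jn; rewrite entry' // /mixed /updated.
rewrite ltn0 andbF orbF; case: ifP => [/andP[h1 h2]|h]; first by [].
by case: ifP => //; lia.
Qed.

End Bounds.

(** * Correctness *)

Opaque address cell new_count merge_expr.

Section Correctness.
Variables (G : sgraph) (n w : nat).
Hypothesis orderG : #|G| = n.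
Hypothesis wide : 16 * n.+2 ^ 2 <= 2 ^ w.
Implicit Types (A : {set G}) (u v x y z : G) (W : G -> label -> nat) (s : state).

Let rank_ltn x : rank x < n. Proof. by rewrite -orderG rank_lt. Qed.

Lemma rank_surj j : j < n -> exists y, rank y = j.
Proof. by rewrite -orderG => jn; exists (enum_val (Ordinal jn)); rewrite /rank enum_valK. Qed.

(** Indexed by numbers, so that [i = n] yields the zero row. *)
Definition row i z : bool := [exists x, (rank x == i) && adj x z].

Lemma row_rank x z : row (rank x) z = adj x z.
Proof.
apply/existsP/idP => [[x' /andP[/eqP/rank_inj->]] //|xz].
by exists x; rewrite eqxx.
Qed.

Lemma row_out i z : n <= i -> row i z = false.
Proof.
move=> ni; apply/existsP => -[x /andP[/eqP xi _]].
by have := rank_ltn x; lia.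
Qed.

Definition diff_count A i y := \sum_(z in A) (row i z != adj y z).

Lemma diff_count_leq A i y : diff_count A i y <= n.
Proof.
apply: leq_trans (_ : \sum_(z in A) 1 <= _); last by rewrite sum1_card -orderG max_card.
by apply: leq_sum => z _; case: (_ != _).
Qed.

(** The right-hand side is the contribution of [x] and [y] themselves to the count; equality says
    that no third vertex of [A] contributes. *)
Lemma prunable_count A t x y : x \in A -> y \in A -> x != y ->
  diff_count A (if t then rank x else n) y = adj x y + (t && adj x y) <-> prunable A t x y.
Proof.
move=> xA yA xy; have rowE z : row (if t then rank x else n) z = t && adj x z.
  by case: (t); rewrite ?row_rank ?row_out.
have xB : x \in A :\ y by rewrite !inE xy xA.
rewrite /diff_count (big_setD1 _ yA) (big_setD1 _ xB) /= !rowE !adj_irrefl andbF.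
have -> : (false != adj y x) = adj x y by rewrite adj_sym; case: (adj _ _).
have -> : ((t && adj x y) != false) = t && adj x y by case: (t && _).
set S := \sum_(_ in _) _; rewrite addnA [adj x y + _ in RHS]addnC.
have -> : (t && adj x y + adj x y + S = t && adj x y + adj x y) <-> (S == 0).
  by split=> [e|/eqP->]; [apply/eqP; lia | rewrite addn0].
rewrite /S sum_nat_eq0; split=> [/forall_inP h|[_ _ _ h]].
  split=> // z zA zx zy; have /h : z \in A :\ y :\ x by rewrite !inE zx zy.
  by rewrite rowE eqb0 negbK => /eqP.
apply/forall_inP => z; rewrite !inE => /and3P[zx zy zA].
by rewrite rowE h // eqxx.
Qed.

(** Two sets occur because the table (for [A]) and the marks (for [A']) are changed by different
    commands and disagree in between. *)
Definition represents A A' W s :=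
  [/\ [/\ regs s 0 = n, regs s 7 = n.+1 & regs s 8 = n.-1],
      forall i y, i <= n -> entry n s i (rank y) = row i y,
      forall i y, i <= n -> entry n s (n.+1 + i) (rank y) = diff_count A i y,
      forall y, entry n s (2 * n + 2) (rank y) = (y \in A') &
      forall l y, entry n s (2 * n + 3 + label_code l) (rank y) = W y l].

Lemma represents_ext A A' W W' s :
  (forall y l, W' y l = W y l) -> represents A A' W s -> represents A A' W' s.
Proof. by move=> e [r0 m1 m2 m3 m4]; split=> // l y; rewrite m4 e. Qed.

Lemma represents_same A A' W s s' rs : cells s' = cells s -> same_regs rs s s' ->
  all (fun r => r \notin rs) [:: 0; 7; 8] ->
  represents A A' W s -> represents A A' W s'.
Proof.
move=> ec er /and4P[n0 n7 n8 _] [[r0 r7 r8] m1 m2 m3 m4].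
by split; rewrite ?er // /entry ec.
Qed.

Lemma represents_bounded A A' W s :
  represents A A' W s -> (forall y l, W y l <= n) -> bounded_mem n s.
Proof.
move=> [_ m1 m2 m3 m4] Wn i j i6 /[dup] jn /rank_surj[y yj]; rewrite -yj.
have [iN|iN] := leqP i n; first by rewrite m1 //; case: row; lia.
have [iN2|iN2] := leqP i (2 * n + 1).
  by rewrite (_ : i = n.+1 + (i - n.+1)) ?m2 ?diff_count_leq //; lia.
have [->|iN3] := eqVneq i (2 * n + 2); first by rewrite m3; case: (_ \in _); lia.
have ri k : i = 2 * n + 3 + label_code k -> entry n s i (rank y) <= n.
  by move->; rewrite m4.
have [|[|[|]]] : i = 2 * n + 3 + 0 \/ i = 2 * n + 3 + 1 \/ i = 2 * n + 3 + 2 \/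
   i = 2 * n + 3 + 3 by lia.
- exact: (ri LE).
- exact: (ri LU).
- exact: (ri LK).
- exact: (ri LZ).
Qed.

Lemma runs_update_represents o A B A' W s v : o = OpAdd \/ o = OpSub ->
  represents A A' W s -> (forall y l, W y l <= n) -> regs s 4 = rank v ->
  (forall i y, diff_count B i y = eval_op o (diff_count A i y) (row i v != adj y v)) ->
  runs w (update_counts o) s (update_time n)
    (fun s' => represents B A' W s' /\ same_regs [:: 1; 2] s s').
Proof.
move=> oP R Wn s4 dB; have bs := represents_bounded R Wn.
have [[r0 r7 r8] m1 m2 m3 m4] := R.
apply: (runs_update wide oP r0 r7 s4 (rank_ltn v) bs) => s' er em; split=> //.
have rk y := rank_ltn y.
split=> [|i y iN|i y iN|y|l y]; first by rewrite !er.
- by rewrite em // /updated; case: ifP; [lia|rewrite m1].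
- rewrite em // /updated ifT; last lia.
  rewrite addKn m2 // dB !m1 ?row_rank //; last exact: ltnW.
  by case: row; case: adj.
- by rewrite em // /updated; case: ifP; [lia|rewrite m3].
- by rewrite em // /updated; case: ifP; [lia|rewrite m4].
Qed.

Lemma runs_insert A A' W s v :
  represents A A' W s -> (forall y l, W y l <= n) -> regs s 4 = rank v -> v \notin A ->
  runs w (update_counts OpAdd) s (update_time n)
    (fun s' => represents (v |: A) A' W s' /\ same_regs [:: 1; 2] s s').
Proof.
move=> R Wn s4 vA; apply: (runs_update_represents _ R) s4 _ => // [|i y]; first by left.
by rewrite /diff_count big_setU1 //= addnC.
Qed.

Lemma runs_delete A A' W s v :
  represents A A' W s -> (forall y l, W y l <= n) -> regs s 4 = rank v -> v \in A ->
  runs w (update_counts OpSub) s (update_time n)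
    (fun s' => represents (A :\ v) A' W s' /\ same_regs [:: 1; 2] s s').
Proof.
move=> R Wn s4 vA; apply: (runs_update_represents _ R) s4 _ => // [|i y]; first by right.
by rewrite /diff_count [in RHS](big_setD1 _ vA) /= addKn.
Qed.

Lemma represents_set_alive A A' A'' W s v b : represents A A' W s ->
  (forall y, (y \in A'') = if y == v then b else y \in A') ->
  represents A A'' W (set_cell s ((2 * n + 2) * n + rank v) b).
Proof.
move=> [r m1 m2 m3 m4] eA; have rk y := rank_ltn y.
split=> // *; rewrite entry_set_cell // ?eqxx /=.
- by rewrite ifF ?m1 //; lia.
- by rewrite ifF ?m2 //; lia.
- by rewrite eA (inj_eq (@rank_inj G)); case: ifP => // _; apply: m3.
- by rewrite ifF ?m4 //; lia.
Qed.

Lemma represents_set_weight A A' W W' s v l c : represents A A' W s ->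
  (forall y k, W' y k = if (k == l) && (y == v) then c else W y k) ->
  represents A A' W' (set_cell s ((2 * n + 3 + label_code l) * n + rank v) c).
Proof.
move=> [r m1 m2 m3 m4] eW; have rk y := rank_ltn y.
split=> // *; rewrite entry_set_cell //.
- by rewrite ifF ?m1 //; lia.
- by rewrite ifF ?m2 //; lia.
- by rewrite ifF ?m3 //; lia.
- by rewrite eW (inj_eq (@rank_inj G)) eqn_add2l (inj_eq (can_inj label_codeK)) m4.
Qed.

Section Rows.
Variable s : state.
Hypotheses (r0 : regs s 0 = n) (r7 : regs s 7 = n.+1).

Lemma value_count_row i : value s (count_row i) = n.+1 + value s i.
Proof. by rewrite /= r7. Qed.

Lemma value_alive_row : value s alive_row = 2 * n + 2.
Proof. by rewrite /= r7; lia. Qed.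

Lemma value_weight_row k : value s (weight_row k) = 2 * n + 3 + k.
Proof. by rewrite /= r7; lia. Qed.

Lemma fits_count_row i : fits w s i -> value s i <= n -> fits w s (count_row i).
Proof. by move=> fi iN; rewrite /= fi r7 !(small wide) //; lia. Qed.

Lemma fits_alive_row : fits w s alive_row.
Proof. by rewrite /= r7 !(small wide) //; lia. Qed.

Lemma fits_weight_row k : k <= 3 -> fits w s (weight_row k).
Proof.
by move=> k3; rewrite -[fits _ _ _]/[&& fits w s alive_row, _ & _]
  fits_alive_row /= r7 !(small wide) //; lia.
Qed.

End Rows.
Opaque count_row alive_row weight_row.

Lemma runs_initialise s : represents set0 set0 (fun _ _ => 0) s -> regs s 3 = 0 ->
  runs w initialise s (n * (update_time n + straight_cost mark_alive + 10) + 8)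
    (fun s' => represents setT setT (@leaf_weight G) s' /\ regs s' 3 = 0).
Proof.
move=> R s3; pose V k := [set y : G | rank y < k].
pose WW k y l := if rank y < k then leaf_weight y l else 0.
apply: (@runs_for _ _ _ _ _ n _ (fun k s' =>
  [/\ regs s' 4 = k, regs s' 3 = 0 & represents (V k) (V k) (WW k) s'])).
- by apply: (small wide); lia.
- by split.
- by move=> k s' _ [s4 _ [[]]].
- move=> k s1 kn [s4 s13 R1]; have [v vk] := rank_surj kn; rewrite -vk in s4.
  have WWn y l : WW k y l <= n.
    by rewrite /WW /leaf_weight; have := leq_b1 (l == LU); case: ifP; lia.
  have vV : v \notin V k by rewrite inE vk ltnn.
  have Vk : v |: V k = V k.+1.
    by apply/setP => y; rewrite !inE ltnS [RHS]leq_eqVlt -vk (inj_eq (@rank_inj G)).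
  apply: runs_seq; apply: runs_weaken (runs_insert R1 WWn s4 vV) (leqnn _) _ => s2 [R2 er].
  have [[r0 r7 _] _ _ _ _] := R2; have r4 : regs s2 4 = rank v by rewrite er.
  have rv := rank_ltn v; have f4 : fits w s2 (Reg 4) by rewrite /= r4 (small wide) //; lia.
  have f1 : 1 < 2 ^ w by apply: (small wide); lia.
  have store_fits s' row : regs s' 0 = n -> regs s' 4 = rank v -> fits w s' row ->
      value s' row <= 2 * n + 6 -> fits w s' (address row (Reg 4)).
    by move=> r0' r4' fr br; apply: (fits_address wide); rewrite //= r4' ?(small wide) //; lia.
  apply: runs_straight => /=.
    rewrite f1 !store_fits ?fits_alive_row ?fits_weight_row //.
      by rewrite value_weight_row //; lia.
    by rewrite value_alive_row //; lia.
  rewrite !er // s4; split=> //; split=> //; first by rewrite /= /update /= er.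
  rewrite !(value_address (n := n)) ?value_alive_row ?value_weight_row //= r4.
  set t1 := set_cell s2 _ _; set t2 := set_cell t1 _ _.
  apply: (@represents_same _ _ _ t2 _ [:: 4]) => //; first exact: same_regs_set.
  apply: (represents_set_weight (l := LU) (W := WW k)).
    apply: (represents_set_alive (A' := V k) (b := true)); first by rewrite -Vk.
    by move=> y; rewrite -Vk !inE; case: (y == v).
  move=> y l; rewrite /WW ltnS leq_eqVlt -vk (inj_eq (@rank_inj G)) /leaf_weight.
  by case: eqP => [->|_] //=; rewrite ?ltnn ?andbT ?andbF //; case: (_ == _).
- move=> s' [_ s3' R']; split=> //; have VT : V n = setT.
    by apply/setP => y; rewrite !inE rank_ltn.
  by rewrite -VT; apply: represents_ext R' => y l; rewrite /WW rank_ltn.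
Qed.

(** * Evaluating the test for a prunable pair *)

Section Test.
Variables (A : {set G}) (W : G -> label -> nat) (s : state) (x y : G).
Hypothesis R : represents A A W s.
Hypotheses (s1 : regs s 1 = rank x) (s2 : regs s 2 = rank y).

Let r0 : regs s 0 = n. Proof. by have [[]] := R. Qed.
Let r7 : regs s 7 = n.+1. Proof. by have [[]] := R. Qed.
Let xn : rank x < n. Proof. exact: rank_ltn. Qed.
Let yn : rank y < n. Proof. exact: rank_ltn. Qed.
Let small := small wide.

Let fits_reg r : r <= 2 -> fits w s (Reg r) /\ value s (Reg r) <= n.
Proof. by case: r => [|[|[|]]] //= _; rewrite ?r0 ?s1 ?s2; split; rewrite ?small //; lia. Qed.

Let alive_cell r z : r <= 2 -> regs s r = rank z ->
  value s (cell alive_row (Reg r)) = (z \in A) /\ fits w s (cell alive_row (Reg r)).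
Proof.
move=> r2 rz; have [_ _ _ m3 _] := R; have [fr br] := fits_reg r2.
have va : value s alive_row = 2 * n + 2 by rewrite value_alive_row.
split; first by rewrite (value_cell (n := n)) // va /= rz m3.
apply: (fits_cell wide) => //; rewrite ?fits_alive_row ?va //; first lia.
by rewrite /= rz m3; have := leq_b1 (z \in A); lia.
Qed.

Let adj_cell : value s (cell (Reg 1) (Reg 2)) = adj x y /\ fits w s (cell (Reg 1) (Reg 2)).
Proof.
have [_ m1 _ _ _] := R; have [f1 b1] := @fits_reg 1 isT; have [f2 b2] := @fits_reg 2 isT.
have e : entry n s (value s (Reg 1)) (value s (Reg 2)) = adj x y.
  by rewrite /= s1 s2 m1 ?row_rank // ltnW.
split; first by rewrite (value_cell (n := n)).
by apply: (fits_cell wide) => //; [lia|rewrite e; have := leq_b1 (adj x y); lia].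
Qed.

Let count_cell (t : bool) (e := cell (count_row (Reg (if t then 1 else 0))) (Reg 2)) :
  value s e = diff_count A (if t then rank x else n) y /\ fits w s e.
Proof.
have [_ _ m2 _ _] := R; have [f2 b2] := @fits_reg 2 isT.
have r1 : (if t then 1 else 0) <= 2 by case: (t).
have [f1 b1] := fits_reg r1.
have v1 : value s (Reg (if t then 1 else 0)) = if t then rank x else n.
  by case: (t) => /=.
have en : entry n s (value s (count_row (Reg (if t then 1 else 0)))) (value s (Reg 2)) =
    diff_count A (if t then rank x else n) y.
  by rewrite value_count_row // v1 [value s (Reg 2)]/= s2 m2 // -v1.
split; first by rewrite (value_cell (n := n)).
apply: (fits_cell wide); rewrite ?fits_count_row ?value_count_row //; first lia.
by rewrite -[X in X <= _]/(entry _ _ _ _) -value_count_row // en;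
  have := diff_count_leq A (if t then rank x else n) y; lia.
Qed.

Lemma value_candidate : value s candidate = [&& x \in A, y \in A & x != y].
Proof.
rewrite -[LHS]/(value s (cell alive_row (Reg 1)) * value s (cell alive_row (Reg 2))
  * (1 - (regs s 1 == regs s 2))).
rewrite (@alive_cell 1 x isT s1).1 (@alive_cell 2 y isT s2).1 s1 s2 (inj_eq (@rank_inj G)).
by case: (x \in A); case: (y \in A); case: (x == y).
Qed.

Lemma fits_candidate : fits w s candidate.
Proof.
have [f1 _] := @fits_reg 1 isT; have [f2 _] := @fits_reg 2 isT.
have [v3 f3] := @alive_cell 1 x isT s1; have [v4 f4] := @alive_cell 2 y isT s2.
have b k : k <= 1 -> k < 2 ^ w by move=> k1; apply: small; lia.
have c := value_candidate.
rewrite -[fits _ _ _]/[&& [&& fits w s (cell alive_row (Reg 1)),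
  fits w s (cell alive_row (Reg 2)) & value s (cell alive_row (Reg 1)) *
  value s (cell alive_row (Reg 2)) < 2 ^ w],
  [&& 1 < 2 ^ w, [&& fits w s (Reg 1), fits w s (Reg 2) & (regs s 1 == regs s 2) < 2 ^ w]
    & 1 - (regs s 1 == regs s 2) < 2 ^ w] & value s candidate < 2 ^ w].
rewrite f1 f2 f3 f4 v3 v4 c !b ?leq_b1 ?leq_subr //.
by case: (x \in A); case: (y \in A).
Qed.

Let testE t : value s (prune_test t) = [&& x \in A, y \in A & x != y] *
  (diff_count A (if t then rank x else n) y == adj x y + (t && adj x y)).
Proof.
rewrite -value_candidate -(count_cell t).1.
have <- : value s (if t then Op OpAdd (cell (Reg 1) (Reg 2)) (cell (Reg 1) (Reg 2))
            else cell (Reg 1) (Reg 2)) = adj x y + (t && adj x y).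
  by case: (t) => /=; rewrite adj_cell.1 ?addn0.
by [].
Qed.

Lemma value_test t : value s (prune_test t) != 0 <-> prunable A t x y.
Proof.
rewrite testE; case: and3P => [[xA yA xy]|no]; last by split=> // -[xA yA xy _]; case: no.
rewrite mul1n; apply: iff_trans (prunable_count t xA yA xy).
by rewrite eqb0 negbK; split=> /eqP.
Qed.

Lemma fits_test t : fits w s (prune_test t).
Proof.
have [v1 f1] := count_cell t; have [v2 f2] := adj_cell.
have f : fits w s (if t then Op OpAdd (cell (Reg 1) (Reg 2)) (cell (Reg 1) (Reg 2))
            else cell (Reg 1) (Reg 2)).
  by case: (t) => //=; rewrite f2 v2 small //; have := leq_b1 (adj x y); lia.
apply/and3P; split; [exact: fits_candidate| apply/and3P; split=> // |].
  by apply: small; apply: leq_trans (leq_b1 _) _; lia.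
rewrite -[X in X < _]/(value s (prune_test t)) testE; apply: small.
by apply: (@leq_trans (1 * 1)); [apply: leq_mul; apply: leq_b1 | lia].
Qed.

End Test.
Opaque prune_test.

Definition selected A s := exists t u v,
  [/\ prunable A t u v, regs s 3 = rank u, regs s 4 = rank v & regs s 5 = t].

Definition search_time := n * (n * (straight_cost search_entry + 10) + 8 + 10) + 8.

Lemma runs_search A W s : represents A A W s ->
  (exists t u v, prunable A t u v) ->
  runs w search s search_time
    (fun s' => [/\ represents A A W s', same_regs [:: 1; 2; 3; 4; 5] s s' & selected A s']).
Proof.
move=> R ex; have [[r0 _ _] _ _ _ _] := R.
(* If a prunable pair precedes position [(i, j)], the registers hold some prunable pair, not
   necessarily that one: the search does not stop early and later hits overwrite earlier ones. *)
pose P i j s' := [/\ cells s' = cells s, same_regs [:: 1; 2; 3; 4; 5] s s' &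
  forall t u v, prunable A t u v -> (rank u < i) || (rank u == i) && (rank v < j) ->
  selected A s'].
apply: (@runs_for _ _ _ _ _ n _ (fun i s' => regs s' 1 = i /\ P i 0 s')).
- by apply: (small wide); lia.
- by split=> //; split=> // [|t u v _]; [exact: same_regs_set | lia].
- by move=> i s' _ [? [_ er _]]; split=> //; rewrite er.
- move=> i s1 i_n [s11 [ec1 er1 sel1]].
  apply: (@runs_for _ _ _ _ _ n _ (fun j s' => [/\ regs s' 1 = i, regs s' 2 = j & P i j s'])).
  + by apply: (small wide); lia.
  + by split=> //; split=> //; apply: same_regs_set.
  + by move=> j s' _ [_ ? [_ er _]]; split=> //; rewrite er.
  + move=> j s2 j_n [s21 s22 [ec2 er2 sel2]].
    have R2 : represents A A W s2 by apply: (represents_same ec2 er2 _ R).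
    have [a ai] := rank_surj i_n; have [b bj] := rank_surj j_n.
    have s2a : regs s2 1 = rank a by rewrite ai.
    have s2b : regs s2 2 = rank b by rewrite bj.
    have fr r : r <= 2 -> fits w s2 (Reg r).
      have bd k : k <= n -> k < 2 ^ w by move=> kn; apply: (small wide); lia.
      case: r => [|[|[|//]]] _ /=; rewrite bd ?s21 ?s22 ?er2 ?r0 //; exact: ltnW.
    have b01 k : k <= 1 -> k < 2 ^ w by move=> k1; apply: (small wide); lia.
    have ft := fits_test R2 s2a s2b; have vt := value_test R2 s2a s2b.
    apply: runs_straight.
      by rewrite /= !ft /= -/(fits w s2 (Reg 1)) -/(fits w s2 (Reg 2)) ?b01 ?(fr 1) ?(fr 2) //;
         case: ifP => //= _; case: ifP.
    have done s' : cells s' = cells s2 -> same_regs [:: 3; 4; 5] s2 s' ->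
        (forall t, prunable A t a b -> selected A s') ->
        (selected A s2 -> selected A s') ->
        regs s' 2 = j /\ [/\ regs (set_reg s' 2 j.+1) 1 = i,
          regs (set_reg s' 2 j.+1) 2 = j.+1 & P i j.+1 (set_reg s' 2 j.+1)].
      move=> ec er good keep; have ri r : r \notin [:: 3; 4; 5] -> regs s' r = regs s2 r by exact: er.
      split; first by rewrite ri.
      split; [by rewrite /= /update /= ri|by []|split; first by rewrite /= ec].
        apply: same_regs_set => // r rn; rewrite ri ?er2 //.
        by apply: contra rn; rewrite !inE => /or3P[]/eqP->.
      move=> t u v puv uv; suff [t' [u' [v' h]]] : selected A s' by exists t', u', v'.
      have [e|ne] := eqVneq (rank u * n + rank v) (i * n + j); last first.
        apply/keep/(sel2 _ _ _ puv); rewrite (eqn_row_col _ _ j_n (rank_ltn v)) in ne.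
        by move: uv ne; lia.
      have /andP[/eqP ui /eqP vj] : (rank u == i) && (rank v == j).
        by rewrite -(eqn_row_col _ _ j_n (rank_ltn v)) e.
      have ua : u = a by apply: rank_inj; rewrite ui ai.
      have vb : v = b by apply: rank_inj; rewrite vj bj.
      by apply: (good t); rewrite -ua -vb.
    have regs3 c k1 k2 k3 : same_regs [:: 3; 4; 5] c (set_reg (set_reg (set_reg c 3 k1) 4 k2) 5 k3).
      by do 3!apply: same_regs_set => //.
    have -> : straight search_entry s2 =
        if value s2 (prune_test true) != 0 then straight (select 1) s2
        else if value s2 (prune_test false) != 0 then straight (select 0) s2 else s2 by [].
    case: ifP => [/vt pt|nt].
      by apply: done => // [|t _|_]; [exact: regs3| |]; exists true, a, b; rewrite /= /update /= s2a s2b.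
    case: ifP => [/vt pf|nf].
      by apply: done => // [|t _|_]; [exact: regs3| |]; exists false, a, b; rewrite /= /update /= s2a s2b.
    by apply: done => // -[] /(proj2 (vt _)); rewrite ?nt ?nf.
  + move=> s' [s1' s2' [ec er sel]]; split=> //; split=> //; split=> //.
      exact: same_regs_set.
    by move=> t u v puv uv; apply: (sel t u v) => //; have := rank_ltn v; lia.
- move=> s' [_ [ec er sel]]; split=> //; first exact: (represents_same ec er _ R).
  by have [t [u [v puv]]] := ex; apply: (sel t u v) => //; rewrite rank_ltn.
Qed.

Lemma label_code_lt4 l : label_code l < 4. Proof. by case: l. Qed.

Lemma straight_load r q x ls s A A' W : represents A A' W s ->
  (forall y l, W y l <= n) -> regs s q = rank x -> q < 9 -> 9 < r ->
  let c := sequence [seq load_weight r q l | l <- ls] in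
  let s' := straight c s in
  [/\ straight_fits w c s, cells s' = cells s,
      same_regs [seq r + label_code l | l <- ls] s s' &
      forall l, l \in ls -> regs s' (r + label_code l) = W x l].
Proof.
move=> + Wn + q9 r9; elim: ls s => [|l ls IH] s R sq //=.
have [[r0 r7 _] _ _ _ m4] := R; have xn := rank_ltn x; have l4 := label_code_lt4 l.
have vw : value s (weight_row (label_code l)) = 2 * n + 3 + label_code l.
  by rewrite value_weight_row.
have ec : value s (cell (weight_row (label_code l)) (Reg q)) = W x l.
  by rewrite (value_cell (n := n)) // vw /= sq m4.
have fc : fits w s (cell (weight_row (label_code l)) (Reg q)).
  apply: (fits_cell wide); rewrite ?fits_weight_row ?vw //= ?sq ?m4 ?(small wide) //; try lia.
  by have := Wn x l; lia.
rewrite fc ec; set s1 := set_reg s _ _.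
have e1 : same_regs [:: r + label_code l] s s1 by apply: same_regs_set; rewrite ?inE.
have R1 : represents A A' W s1.
  by apply: (represents_same _ e1 _ R) => //=; rewrite !inE; lia.
have sq1 : regs s1 q = rank x by rewrite e1 // inE; lia.
have [fi ci ei li] := IH s1 R1 sq1; split=> //.
  move=> k; rewrite inE negb_or => /andP[kl kls].
  by rewrite ei // e1 // inE.
move=> k; rewrite inE; have [kls _|kls] := boolP (k \in ls); first exact: li.
rewrite orbF => /eqP kl; rewrite kl in kls *; rewrite ei; first by rewrite /s1 /= /update eqxx.
by apply: contra kls => /mapP[k' k'ls /addnI/(can_inj label_codeK)->].
Qed.

(** The merged weights are computed from registers alone, so overwriting the weights of [u] one by
    one does not disturb those still to be stored. *)
Lemma straight_store b t u c ls s A A' W : represents A A' W s ->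
  regs s 3 = rank u ->
  (forall s' l, regs s' = regs s ->
     fits w s' (merge_expr b t l) /\ value s' (merge_expr b t l) = c l) ->
  let p := sequence [seq store_weight b t l | l <- ls] in
  [/\ straight_fits w p s, regs (straight p s) = regs s &
      represents A A' (fun y k => if (k \in ls) && (y == u) then c k else W y k)
        (straight p s)].
Proof.
elim: ls s W => [|l ls IH] s W R s3 ep //=.
have [[r0 r7 _] _ _ _ m4] := R; have un := rank_ltn u; have l4 := label_code_lt4 l.
have vw : value s (weight_row (label_code l)) = 2 * n + 3 + label_code l.
  by rewrite value_weight_row.
have fa : fits w s (address (weight_row (label_code l)) (Reg 3)).
  by apply: (fits_address wide); rewrite ?fits_weight_row ?vw //= ?s3 ?(small wide) //; lia.
have [fe ee] := ep s l erefl.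
rewrite fa fe ee (value_address (n := n)) // vw /= s3.
set s1 := set_cell s _ _.
have R1 : represents A A' (fun y k => if (k == l) && (y == u) then c l else W y k) s1.
  exact: represents_set_weight R _.
have [fi ri Ri] := IH s1 _ R1 s3 ep; split=> //.
apply: represents_ext Ri => y k; rewrite inE.
by case: (y == u); rewrite ?andbF // !andbT; case: eqP => [->|_] //=; case: (_ \in ls).
Qed.

Lemma runs_merge A (t : bool) u v W s : represents A A W s -> (forall y l, W y l <= n) ->
  (forall k l, W u k + W v l <= n) -> regs s 3 = rank u -> regs s 4 = rank v -> regs s 5 = t ->
  runs w merge_selected s (straight_cost merge_selected)
    (fun s' => represents A A (merge_weights t u v W) s' /\
               same_regs (iota 10 8) s s').
Proof.
move=> R Wn Wuv s3 s4 s5.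
rewrite (_ : straight_cost merge_selected = straight_cost (load_weights 10 3) +
  (straight_cost (load_weights 14 4) + (cost (cell (Reg 3) (Reg 4)) +
   maxn (cost (Reg 5) + maxn (straight_cost (store_weights true true))
           (straight_cost (store_weights true false))).+1
        (cost (Reg 5) + maxn (straight_cost (store_weights false true))
           (straight_cost (store_weights false false))).+1).+1)); last by [].
have [f1 c1 e1 l1] := @straight_load 10 3 u labels s A A W R Wn s3 isT isT.
apply/runs_seq/runs_straight => //; set t1 := straight _ s in c1 e1 l1 *; clearbody t1.
have R1 : represents A A W t1 by apply: (represents_same c1 e1 _ R).
have t14 : regs t1 4 = rank v by rewrite e1.
have [f2 c2 e2 l2] := @straight_load 14 4 v labels t1 A A W R1 Wn t14 isT isT.
apply/runs_seq/runs_straight => //; set t2 := straight _ t1 in c2 e2 l2 *; clearbody t2.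
have R2 : represents A A W t2 by apply: (represents_same c2 e2 _ R1).
have mem_labels l : l \in labels by case: l.
have t2u k : regs t2 (10 + label_code k) = W u k by rewrite e2 ?l1 //; case: k.
have t2v k : regs t2 (14 + label_code k) = W v k by rewrite l2.
have t23 : regs t2 3 = rank u by rewrite e2 // e1.
have t24 : regs t2 4 = rank v by rewrite e2 // e1.
have t25 : regs t2 5 = t by rewrite e2 // e1.
have er : same_regs (iota 10 8) s t2.
  move=> r rn; rewrite e2 ?e1 //; apply: contra rn => /mapP[l _ ->];
    by rewrite mem_iota; have := label_code_lt4 l; lia.
have [[r0 r7 _] m1 _ _ _] := R2; have un := rank_ltn u; have vn := rank_ltn v.
have fr r x : regs t2 r = rank x -> fits w t2 (Reg r).
  by move=> /= ->; apply: (small wide); have := rank_ltn x; lia.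
have adjE : entry n t2 (rank u) (rank v) = adj u v by rewrite m1 ?row_rank // ltnW.
have va : value t2 (cell (Reg 3) (Reg 4)) = adj u v.
  by rewrite (value_cell (n := n)) //= t23 t24.
have fa : fits w t2 (cell (Reg 3) (Reg 4)).
  by apply: (fits_cell wide); rewrite ?(fr 3 u) ?(fr 4 v) //= ?t23 ?t24 ?adjE //; lia.
have f5 : fits w t2 (Reg 5) by rewrite /= t25 (small wide) //; have := leq_b1 t; lia.
have store b q : b = adj u v -> q = t ->
    runs w (store_weights b q) t2 (straight_cost (store_weights b q))
     (fun s' => represents A A (merge_weights t u v W) s' /\ same_regs (iota 10 8) s s').
  move=> eb eq_; have ep s' l : regs s' = regs t2 ->
      fits w s' (merge_expr b q l) /\
      value s' (merge_expr b q l) = merge_weight b q (W u) (W v) l.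
    move=> ers; have [||//|f e _] := merge_exprP wide (s := s') b q l (wu := W u) (wv := W v);
      by [split | move=> k; rewrite ers].
  have [f e R3] := straight_store labels R2 t23 ep.
  apply: runs_straight => //; split; last by move=> r rn; rewrite e er.
  by apply: represents_ext R3 => y k; rewrite mem_labels /merge_weights eb eq_; case: eqP => [->|].
apply: runs_if => //; rewrite va => va'; apply: runs_if => //; rewrite [value _ _]/= t25 => t25';
  apply: store; by case: (adj u v) va'; case: (t) t25'.
Qed.

(* Labels have weight at most the number of vertices merged so far. *)
Definition budget A W := exists b : G -> nat,
  [/\ forall y l, W y l <= b y, \sum_(y in A) b y <= n & forall y, b y <= n].

Lemma budget_leq A W : budget A W -> forall y l, W y l <= n.
Proof. by move=> [b [Wb _ bn]] y l; apply: leq_trans (Wb y l) (bn y). Qed.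

Lemma budget_pair A W u v k l : budget A W -> u \in A -> v \in A -> u != v ->
  W u k + W v l <= n.
Proof.
move=> [b [Wb bs _]] uA vA uv; apply: leq_trans bs.
rewrite (big_setD1 v) //= (big_setD1 u) ?inE ?uv //=.
by have := Wb u k; have := Wb v l; lia.
Qed.

Lemma budget_merge A (t : bool) u v W : budget A W -> u \in A -> v \in A -> u != v ->
  budget (A :\ v) (merge_weights t u v W).
Proof.
move=> [b [Wb bs bn]] uA vA uv; exists (fun y => if y == u then b u + b v else b y).
have uB : u \in A :\ v by rewrite !inE uv uA.
have sumE : \sum_(y in A :\ v) (if y == u then b u + b v else b y) = \sum_(y in A) b y.
  rewrite [LHS](big_setD1 u) // [RHS](big_setD1 v) // [in RHS](big_setD1 u) //=.
  rewrite eqxx addnA [b v + _]addnC; congr (_ + _).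
  by apply: eq_bigr => y; rewrite !inE => /andP[/negPf->].
split.
- move=> y l; rewrite /merge_weights; case: eqP => [_|//].
  have [k [k' [_ <-]]] := merge_weight_attained (adj u v) t (W u) (W v) l.
  exact: leq_add.
- by rewrite sumE.
- move=> y; case: eqP => [_|//]; apply: leq_trans bs.
  by rewrite (big_setD1 v) //= (big_setD1 u) //= addnA [b v + _]addnC leq_addr.
Qed.

Definition prune_time := search_time + (straight_cost merge_selected +
  (straight_cost (Store (address alive_row (Reg 4)) (Defs.Num 0)) + update_time n)).

Lemma runs_prune A W s : represents A A W s -> budget A W ->
  (exists t u v, prunable A t u v) ->
  runs w prune s prune_time (fun s' => exists t u v,
    [/\ prunable A t u v, represents (A :\ v) (A :\ v) (merge_weights t u v W) s',
        regs s' 3 = rank u & regs s' 6 = regs s 6]).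
Proof.
move=> R B ex; apply: runs_seq.
apply: runs_weaken (runs_search R ex) (leqnn _) _ => s1 [R1 e1 [t [u [v [puv s3 s4 s5]]]]].
have [uA vA uv _] := puv.
apply/runs_seq/(runs_weaken _ (leqnn _)).
  apply: (runs_merge R1 (budget_leq B) _ s3 s4 s5) => k l.
  exact: (budget_pair k l B).
move=> s2 [R2 e2]; have t4 : regs s2 4 = rank v by rewrite e2.
have [[r0 r7 _] _ _ _ _] := R2; have vn := rank_ltn v.
have va : value s2 alive_row = 2 * n + 2 by rewrite value_alive_row.
apply/runs_seq/runs_straight.
  rewrite /= (small wide) // andbT; apply: (fits_address wide);
  by rewrite ?fits_alive_row ?va //= ?t4 ?(small wide) //; lia.
rewrite /= (value_address (n := n)) // va /= t4.
have R3 := represents_set_alive (A'' := A :\ v) (v := v) (b := false) R2.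
have Wn := budget_leq (budget_merge t B uA vA uv).
apply: runs_weaken (runs_delete (R3 _) Wn t4 vA) (leqnn _) _.
  by move=> y; rewrite !inE; case: (y == v).
move=> s3' [R4 e3]; exists t, u, v; split=> //.
  by rewrite e3 //= e2.
by rewrite e3 //= e2 // e1.
Qed.

(** * The rounds of deletion and the whole run *)

Hypothesis dhG : distance_hereditary G.

(** The invariant carries optima backwards: an optimum for the remaining vertices with the current
    weights is one for the original problem. With one vertex left the optimum is explicit, and
    uniqueness identifies it with the packing number. *)
Lemma runs_rounds s : represents setT setT (@leaf_weight G) s -> regs s 3 = 0 ->
  runs w (For 6 8 prune) s (n.-1 * (prune_time + 10) + 8)
    (fun s' => regs s' 0 = n /\ regs s' 7 = n.+1 /\ (0 < n -> exists u,
       [/\ regs s' 3 = rank u,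
           forall l, entry n s' (2 * n + 3 + label_code l) (rank u) <= n &
           single_weight (fun l => entry n s' (2 * n + 3 + label_code l) (rank u))
             = eop_number G])).
Proof.
move=> R s3.
apply: (@runs_for _ _ _ _ _ n.-1 _ (fun k s' => regs s' 6 = k /\ exists A W,
  [/\ represents A A W s', budget A W, #|A| = n - k,
      0 < n -> exists2 u, u \in A & regs s' 3 = rank u &
      forall m, optimum A W m -> optimum setT (@leaf_weight G) m])).
- by apply: (small wide); lia.
- split=> //; exists setT, (@leaf_weight G); split=> //.
  + exists (fun=> 1); split=> [y l||y]; first exact: leq_b1.
      by rewrite sum1_card cardsT orderG.
    by have := rank_ltn y; lia.
  + by rewrite cardsT orderG subn0.
  + by move=> /rank_surj[u u0]; exists u; [exact: in_setT | rewrite u0 /= /update /= s3].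
- by move=> k s' _ [? [A [W [[[]]]]]].
- move=> k s' kn [s6 [A [W [R' B cA _ opt]]]].
  have A1 : 1 < #|A| by lia.
  apply: runs_weaken (runs_prune R' B (dh_prunable dhG A1)) (leqnn _) _.
  move=> s1 [t [u [v [puv R1 s13 s16]]]]; have [uA vA uv _] := puv.
  split; first by rewrite s16.
  split=> //; exists (A :\ v), (merge_weights t u v W); split.
  + by apply: (@represents_same _ _ _ s1 _ [:: 6] _ _ _ R1) => //; apply: same_regs_set.
  + exact: budget_merge.
  + by have := cardsD1 v A; rewrite vA; lia.
  + by exists u; rewrite ?inE ?uv.
  + by move=> m /(optimum_merge puv); apply: opt.
move=> s' [_ [A [W [R' B cA ex opt]]]]; have [[r0 r7 _] _ _ _ m4] := R'.
split=> //; split=> // n0; have [u uA s3u] := ex n0; exists u; split=> //.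
  by move=> l; rewrite m4; apply: budget_leq B _ _.
have eA : A = [set u].
  have /cards1P[u' eA] : #|A| == 1 by rewrite cA; lia.
  by move: uA; rewrite eA inE => /eqP->.
have eW : single_weight (fun l => entry n s' (2 * n + 3 + label_code l) (rank u)) =
    single_weight (W u) by rewrite /single_weight !m4.
rewrite eW; apply: optimum_unique (eop_optimum G); apply: opt; rewrite eA.
exact: optimum1.
Qed.

Lemma runs_answer s : regs s 0 = n -> regs s 7 = n.+1 -> (0 < n -> exists u,
    [/\ regs s 3 = rank u,
        forall l, entry n s (2 * n + 3 + label_code l) (rank u) <= n &
        single_weight (fun l => entry n s (2 * n + 3 + label_code l) (rank u))
          = eop_number G]) ->
  runs w answer s (straight_cost answer) (fun s' => output s' = eop_number G).
Proof.
move=> r0 r7 ex; have f0 : fits w s (Reg 0) by rewrite /= r0 (small wide) //; lia.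
rewrite (_ : straight_cost answer = (cost (Reg 0) + maxn (cost answer_expr).+1 1).+1); last by [].
apply: runs_if => //; rewrite [value _ _]/= r0 => n0; last first.
  (* For the empty graph register 0 already contains the answer, zero. *)
  apply: runs_skip; rewrite /output r0 n0; have [[f _ <-] _] := eop_optimum G.
  rewrite /weight big1 // => x _; by have := rank_ltn x; rewrite n0.
have [|u [s3 En es]] := ex; first by rewrite lt0n.
have un := rank_ltn u.
have vc l : value s (cell (weight_row (label_code l)) (Reg 3)) =
    entry n s (2 * n + 3 + label_code l) (rank u).
  by rewrite (value_cell (n := n)) // value_weight_row //= s3.
have fc l : fits w s (cell (weight_row (label_code l)) (Reg 3)).
  have l4 := label_code_lt4 l; have := En l; move=> El.
  apply: (fits_cell wide); rewrite ?fits_weight_row ?value_weight_row //= ?s3 ?(small wide) //; lia.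
have ve : value s answer_expr = eop_number G.
  rewrite -es /single_weight -!vc !maxnE; by [].
apply: runs_set; last by rewrite ve.
have bd k : k <= n -> k < 2 ^ w by move=> kn; apply: (small wide); lia.
have E0 := En LE; have E2 := En LK; have E3 := En LZ.
move: (fc LE) (fc LK) (fc LZ) E0 E2 E3; rewrite -!vc /= => -> -> -> E0 E2 E3.
by rewrite -!maxnE !bd // ?geq_max ?E0 ?E2 ?E3 //; lia.
Qed.

Definition total_time :=
  4 + (4 + (n * (update_time n + straight_cost mark_alive + 10) + 8 +
  (n.-1 * (prune_time + 10) + 8 + straight_cost answer))).

(** Rows of the input memory from [n] on are zero, which is right for the zero row, the table of the
    empty set, the marks and the weights alike. *)
Lemma represents_input s : cells s = cells (input G) ->
  [/\ regs s 0 = n, regs s 7 = n.+1 & regs s 8 = n.-1] ->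
  represents set0 set0 (fun _ _ => 0) s.
Proof.
move=> ec er; have ce i y : entry n s i (rank y) = row i y.
  rewrite /entry ec -[LHS]/(nat_of_bool [exists x : G, exists z : G,
    (i * n + rank y == rank x * #|G| + rank z) && adj x z]).
  congr (nat_of_bool _); rewrite orderG; apply/existsP/existsP => -[x].
    case/existsP=> z /andP[]; rewrite (eqn_row_col _ _ (rank_ltn z) (rank_ltn y)).
    by case/andP=> /eqP-> /eqP/rank_inj-> xz; exists x; rewrite eqxx.
  by case/andP=> /eqP xi xy; exists x; apply/existsP; exists y; rewrite -xi eqxx.
split=> // [i y _|y|l y]; rewrite ce row_out ?inE //; try lia.
by rewrite /diff_count big_set0.
Qed.

Lemma runs_program : runs w eop_program (input G) total_time
  (fun s => output s = eop_number G).
Proof.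
have i0 : regs (input G) 0 = n by rewrite /= orderG.
have sm k : k <= n.+1 -> k < 2 ^ w by move=> kn; apply: (small wide); lia.
apply/runs_seq/(@runs_set _ 7 (Op OpAdd (Reg 0) (Defs.Num 1))).
  by rewrite /= orderG !sm //; lia.
apply/runs_seq/(@runs_set _ 8 (Op OpSub (Reg 0) (Defs.Num 1))).
  by rewrite /= /update /= orderG !sm //; lia.
set s := set_reg _ 8 _; have R : represents set0 set0 (fun _ _ => 0) s.
  by apply: represents_input; rewrite // /s /= /update /= orderG addn1 subn1.
have s3 : regs s 3 = 0 by [].
apply/runs_seq/(runs_weaken (runs_initialise R s3) (leqnn _)) => s1 [R1 s13].
apply/runs_seq/(runs_weaken (runs_rounds R1 s13) (leqnn _)) => s2 [r0 [r7 ex]].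
exact: runs_answer.
Qed.

End Correctness.

(** * Running time *)

Lemma update_time_leq : exists c, forall n, 0 < n -> update_time n <= c * n ^ 2.
Proof.
exists (2 * straight_cost (update_entry OpAdd) + 64) => -[//|m] _.
rewrite /update_time; move: (straight_cost _) => k.
by rewrite expnS expn1; nia.
Qed.

Lemma search_time_leq : exists c, forall n, 0 < n -> search_time n <= c * n ^ 2.
Proof.
exists (straight_cost search_entry + 36) => -[//|m] _.
rewrite /search_time; move: (straight_cost _) => k.
by rewrite expnS expn1; nia.
Qed.

Lemma prune_time_leq : exists c, forall n, 0 < n -> prune_time n <= c * n ^ 2.
Proof.
have [c1 h1] := update_time_leq; have [c2 h2] := search_time_leq.
pose k := straight_cost merge_selected +
  straight_cost (Store (address alive_row (Reg 4)) (Defs.Num 0)).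
exists (c1 + c2 + k) => n n0; have := h1 n n0; have := h2 n n0.
have : k <= k * n ^ 2 by rewrite leq_pmulr // expn_gt0 n0.
rewrite /prune_time addnA -/k mulnDl; lia.
Qed.

Lemma total_time_leq : exists c, forall n, 0 < n -> total_time n <= c * n ^ 3.
Proof.
have [c1 h1] := update_time_leq; have [c2 h2] := prune_time_leq.
exists (c1 + c2 + straight_cost mark_alive + straight_cost answer + 44) => n n0.
have := h1 n n0; have := h2 n n0; rewrite /total_time.
move: (straight_cost _) (straight_cost _) (update_time n) (prune_time n) => k1 k2 u p.
rewrite !expnS expn0 muln1; case: n n0 {h1 h2} => // m _ hp hu.
have h3 : m.+1 * u <= c1 * (m.+1 * (m.+1 * m.+1)).
  by rewrite mulnCA leq_pmul2l.
have h4 : m * p <= c2 * (m.+1 * (m.+1 * m.+1)).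
  by rewrite mulnCA leq_mul.
rewrite /=; nia.
Qed.

Theorem theorem8 :
  solvable_in_time distance_hereditary eop_number (fun n => n ^ 3).
Proof.
exists eop_program, 7, total_time; split.
  (* The threshold is 1 because the program takes positive time even for [n = 0], where the cubic
     bound vanishes. *)
  by have [c h] := total_time_leq; exists c, 1.
move=> G dhG; set w := _ * _.
have wide : 16 * #|G|.+2 ^ 2 <= 2 ^ w.
  have le : #|G|.+2 <= 2 ^ up_log 2 #|G|.+2 by apply: up_logP.
  (* The factor 7 is 5 + 2: two powers of [#|G|.+2] give the square, and the other five are at least
     [2 ^ 5], which covers the constant 16. *)
  rewrite /w [7 * _]mulnC expnM; apply: (@leq_trans (#|G|.+2 ^ 7)); last by rewrite leq_exp2r.
  rewrite -[7]/(5 + 2) expnD leq_mul2r; apply/orP; right.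
  by apply: (@leq_trans (2 ^ 5)); rewrite // leq_exp2r.
have [t [s [ex le out]]] := runs_program erefl wide dhG.
by exists t, s.
Qed.
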